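(* There is no total recursive function $f$ such that $f(D_{\exists\mathrm{MSO}}[F])\ge D[F]$ for all graphs $F$. Moreover, this remains true if $D_{\exists\mathrm{MSO}}[F]$ is replaced by the minimum quantifier depth of a formula of the form $\exists X\,\Phi$ (exactly one existential monadic second-order quantifier followed by a first-order formula $\Phi$) defining the class of graphs containing an induced copy of $F$.
   Context: Graphs are finite, simple, undirected, loopless. First-order formulas about graphs use only adjacency $\sim$ and equality $=$. $D[F]$ is the minimum quantifier depth of a first-order sentence $\Phi$ such that for every graph $G$, $G\models\Phi$ iff $G$ contains an induced subgraph isomorphic to $F$. Existential monadic second-order logic consists of formulas $\exists X_1\ldots\exists X_m\,\Phi$ where $X_1,\dots,X_m$ range over vertex subsets and $\Phi$ is first-order (with membership atoms $x\in X_i$); its quantifier depth is $m$ plus the quantifier depth of $\Phi$. $D_{\exists\mathrm{MSO}}[F]$ is the minimum quantifier depth of such a formula defining the class of graphs containing an induced copy of $F$. *)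

(* Defs.v *)
From mathcomp Require Import all_boot.
From mathcomp Require Import boolp.

Set Implicit Arguments.
Unset Strict Implicit.
Unset Printing Implicit Defensive.

Record sgraph := SGraph {
  vert :> finType;
  adj : rel vert;
  adj_sym : symmetric adj;
  adj_irrefl : irreflexive adj }.

Definition iso (G H : sgraph) : Prop :=
  exists f : G -> H, bijective f /\ forall x y, adj (f x) (f y) = adj x y.

Section Induced.
Variables (G : sgraph) (S : {set G}).
Let V : finType := {x : G | x \in S}.
Definition induced_adj : rel V := fun x y => adj (val x) (val y).
Lemma induced_sym : symmetric induced_adj.
Proof. by move=> x y; apply: adj_sym. Qed.
Lemma induced_irrefl : irreflexive induced_adj.
Proof. by move=> x; apply: adj_irrefl. Qed.
Definition induced : sgraph := SGraph induced_sym induced_irrefl.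
End Induced.

Definition contains_induced (F G : sgraph) : Prop :=
  exists S : {set G}, iso (induced S) F.

(* [fo m n]: first-order formulas with free set variables among X_0, ...,
   X_(m-1) and free vertex variables among n well-scoped de Bruijn indices;
   index 0 is bound by the innermost quantifier. There are no nullary
   connectives. *)
Inductive fo (m : nat) : nat -> Type :=
| Adj n : 'I_n -> 'I_n -> fo m n
| Eq n : 'I_n -> 'I_n -> fo m n
| Mem n : 'I_n -> 'I_m -> fo m n
| Neg n : fo m n -> fo m n
| And n : fo m n -> fo m n -> fo m n
| Or n : fo m n -> fo m n -> fo m n
| Ex n : fo m n.+1 -> fo m n
| All n : fo m n.+1 -> fo m n.

Arguments Adj {m n}.
Arguments Eq {m n}.
Arguments Mem {m n}.

Fixpoint qdepth m n (p : fo m n) : nat :=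
  match p with
  | Adj _ _ _ | Eq _ _ _ | Mem _ _ _ => 0
  | Neg _ p => qdepth p
  | And _ p q | Or _ p q => maxn (qdepth p) (qdepth q)
  | Ex _ p | All _ p => (qdepth p).+1
  end.

Fixpoint sat (G : sgraph) m (X : m.-tuple {set G}) n (p : fo m n) :
    n.-tuple G -> bool :=
  match p with
  | Adj _ i j => fun e => adj (tnth e i) (tnth e j)
  | Eq _ i j => fun e => tnth e i == tnth e j
  | Mem _ i j => fun e => tnth e i \in tnth X j
  | Neg _ p => fun e => ~~ sat X p e
  | And _ p q => fun e => sat X p e && sat X q e
  | Or _ p q => fun e => sat X p e || sat X q e
  | Ex _ p => fun e => [exists x : G, sat X p [tuple of x :: e]]
  | All _ p => fun e => [forall x : G, sat X p [tuple of x :: e]]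
  end.

(* [models G p] is the truth in G of  exists X_0 ... X_(m-1), p;  for m = 0 it
   is the truth of the first-order sentence p. *)
Definition models (G : sgraph) m (p : fo m 0) : Prop :=
  exists X : m.-tuple {set G}, sat X p [tuple].

Definition defines_induced (F : sgraph) m (p : fo m 0) : Prop :=
  forall G : sgraph, models G p <-> contains_induced F G.

Section Witness.
Variable m : nat.

Definition fo_top n : fo m n :=
  let t := Ex (Eq ord0 ord0) in Or t (Neg t).

Fixpoint fo_exs n : fo m n -> fo m 0 :=
  match n with
  | 0 => id
  | n'.+1 => fun p => fo_exs (Ex p)
  end.

Definition fo_conj n (s : seq (fo m n)) : fo m n :=
  foldr (@And m n) (fo_top n) s.

Definition fo_lit (F : sgraph) (ij : 'I_#|F| * 'I_#|F|) : fo m #|F| :=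
  let: (i, j) := ij in
  if i == j then Eq i j
  else if adj (enum_val i) (enum_val j) then Adj i j
  else And (Neg (Adj i j)) (Neg (Eq i j)).

Definition fo_diagram (F : sgraph) : fo m 0 :=
  fo_exs (fo_conj [seq fo_lit ij | ij <- enum {: 'I_#|F| * 'I_#|F|}]).

Lemma sat_exs (G : sgraph) (X : m.-tuple {set G}) n (p : fo m n) :
  sat X (fo_exs p) [tuple] <-> exists e : n.-tuple G, sat X p e.
Proof.
elim: n p => [|n IHn] p /=.
  by split=> [h|[e]]; [exists [tuple] | rewrite (tuple0 e)].
rewrite IHn; split=> [[e /existsP[x h]]|[e]].
  by exists [tuple of x :: e].
case/tupleP: e => x e h.
by exists e; apply/existsP; exists x.
Qed.

Lemma sat_conj (G : sgraph) (X : m.-tuple {set G}) n (s : seq (fo m n)) e :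
  sat X (fo_conj s) e = all (fun p => sat X p e) s.
Proof. by elim: s => [|p s IHs] /=; [rewrite orbN | rewrite IHs]. Qed.

Lemma fo_diagramP (F : sgraph) : defines_induced F (fo_diagram F).
Proof.
move=> G; split.
- case=> X /sat_exs[e]; rewrite sat_conj all_map => /allP h.
  pose g (x : F) : G := tnth e (enum_rank x).
  have lit x y : sat X (fo_lit (enum_rank x, enum_rank y)) e.
    by apply: h; rewrite mem_enum.
  have g_inj : injective g.
    move=> x y gxy; apply/eqP; apply: contraT => nxy.
    have := lit x y; rewrite /= (inj_eq enum_rank_inj) (negPf nxy) !enum_rankK.
    by case: ifP => _ /=; rewrite -/(g x) -/(g y) gxy ?adj_irrefl // eqxx andbF.
  have g_adj x y : adj (g x) (g y) = adj x y.
    have := lit x y; rewrite /= (inj_eq enum_rank_inj) !enum_rankK.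
    case: (eqVneq x y) => [-> _|_]; first by rewrite !adj_irrefl.
    by case: ifP => _ //= /andP[/negPf].
  exists [set g x | x : F].
  have gP (u : induced [set g x | x : F]) : exists x : F, g x == val u.
    by have /imsetP[x _ ux] := valP u; exists x; apply/eqP.
  pose f u := xchoose (gP u).
  have fK u : g (f u) = val u by apply/eqP; apply: (xchooseP (gP u)).
  exists f; split; last by move=> u v; rewrite -g_adj !fK.
  pose f' (x : F) : induced [set g x | x : F] :=
    Sub (g x) (imset_f g (isT : x \in F)).
  exists f' => [u|x]; first by apply: val_inj; rewrite /= fK.
  by apply: g_inj; rewrite fK.
- case=> S [f [[g fK gK] f_adj]].
  exists [tuple of nseq m set0]; apply/sat_exs.
  exists [tuple val (g (enum_val i)) | i < #|F|].
  rewrite sat_conj all_map; apply/allP => -[i j] _ /=.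
  have eq_g k l : (val (g (enum_val k)) == val (g (enum_val l))) = (k == l).
    by rewrite (inj_eq val_inj) (can_eq gK) (inj_eq enum_val_inj).
  have adj_g x y : adj (val (g x)) (val (g y)) = adj x y.
    by rewrite -{2}(gK x) -{2}(gK y) f_adj.
  case: ifP => [/eqP->|nij] /=; first exact: eqxx.
  case: ifP => a /=; rewrite !tnth_mktuple adj_g a //=.
  by rewrite eq_g nij.
Qed.

End Witness.

Section Depth.
Variable F : sgraph.

Definition has_fo_depth (d : nat) : Prop :=
  exists p : fo 0 0, defines_induced F p /\ qdepth p = d.

Definition has_emso_depth (d : nat) : Prop :=
  exists m (p : fo m 0), defines_induced F p /\ m + qdepth p = d.

Definition has_emso1_depth (d : nat) : Prop :=
  exists p : fo 1 0, defines_induced F p /\ 1 + qdepth p = d.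

Lemma ex_fo_depth : exists d, `[< has_fo_depth d >].
Proof.
exists (qdepth (fo_diagram 0 F)); apply/asboolP.
by exists (fo_diagram 0 F); split=> //; apply: fo_diagramP.
Qed.

Lemma ex_emso1_depth : exists d, `[< has_emso1_depth d >].
Proof.
exists (1 + qdepth (fo_diagram 1 F)); apply/asboolP.
by exists (fo_diagram 1 F); split=> //; apply: fo_diagramP.
Qed.

Lemma ex_emso_depth : exists d, `[< has_emso_depth d >].
Proof.
have [d /asboolP[p hp]] := ex_emso1_depth.
by exists d; apply/asboolP; exists 1, p.
Qed.

Definition D : nat := ex_minn ex_fo_depth.
Definition D_EMSO : nat := ex_minn ex_emso_depth.
Definition D_EMSO1 : nat := ex_minn ex_emso1_depth.

End Depth.

(* Kleene's partial recursive functions: codes of n-ary functions, and their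
   graphs as relations. *)
Inductive recf : nat -> Type :=
| Rzero n : recf n
| Rsucc : recf 1
| Rproj n : 'I_n -> recf n
| Rcomp k n : recf k -> ('I_k -> recf n) -> recf n
| Rprec n : recf n -> recf n.+2 -> recf n.+1
| Rmu n : recf n.+1 -> recf n.

(* [primrec_graph g h k y]: y is the value at k of the function with value g
   at 0 and step function h. *)
Fixpoint primrec_graph (g : nat -> Prop) (h : nat -> nat -> nat -> Prop)
    (k : nat) : nat -> Prop :=
  match k with
  | 0 => g
  | k'.+1 => fun y => exists2 z, primrec_graph g h k' z & h k' z y
  end.

Fixpoint computes n (f : recf n) : n.-tuple nat -> nat -> Prop :=
  match f with
  | Rzero _ => fun _ y => y = 0
  | Rsucc => fun v y => y = (thead v).+1
  | Rproj _ i => fun v y => y = tnth v i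
  | Rcomp k _ g h => fun v y =>
      exists2 w : k.-tuple nat,
        forall i, computes (h i) v (tnth w i) & computes g w y
  | Rprec _ g h => fun v y =>
      let u := [tuple of behead v] in
      primrec_graph (computes g u)
        (fun k z => computes h [tuple of k :: z :: u]) (thead v) y
  | Rmu _ g => fun v y =>
      computes g [tuple of y :: v] 0 /\
      forall z, z < y -> exists k, computes g [tuple of z :: v] k.+1
  end.

Lemma computes_functional n (f : recf n) v y1 y2 :
  computes f v y1 -> computes f v y2 -> y1 = y2.
Proof.
elim: f v y1 y2 => {n}
  [n|  |n i|k n g IHg h IHh|n g IHg h IHh|n g IHg] v y1 y2 /=;
  try by move=> -> ->.
- case=> w1 h1 g1 [w2 h2 g2].
  suff eq_w : w1 = w2 by move: g2; rewrite -eq_w; apply: IHg.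
  by apply: eq_from_tnth => i; apply: IHh (h1 i) (h2 i).
- elim: (thead v) y1 y2 => [|k IHk] y1 y2 /=; first exact: IHg.
  case=> z1 r1 s1 [z2 r2 s2].
  by move: s2; rewrite -(IHk _ _ r1 r2); apply: IHh.
- case=> g1 m1 [g2 m2]; case: (ltngtP y1 y2) => // lt.
    by have [k /(IHg _ _ _ g1)] := m2 _ lt.
  by have [k /(IHg _ _ _ g2)] := m1 _ lt.
Qed.

Definition total_recursive (f : nat -> nat) : Prop :=
  exists c : recf 1, forall x, computes c [tuple x] (f x).

(* Main.v *)
Require Import Defs.
From mathcomp Require Import all_boot.
From mathcomp Require Import boolp zify.

(** For a graph F and a number c of colours let K_c x F be the graph on pairs
(colour, vertex of F) in which two pairs are adjacent iff the colours differ and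
the vertices are adjacent. In the Ehrenfeucht game Duplicator can copy the
F-coordinate and play on the colours alone, so K_c x F and K_c' x F agree on all
sentences of depth at most min(c, c'). For c >= |F| this graph contains F, while
for c smaller than the clique number of F it does not; hence D[F] is at least the
clique number of F.

On the other hand D_EMSO1[F] is bounded by the depth of a first-order description
of F, since X can be taken to be the vertex set of the copy. Given a code of a
total recursive f, consider evaluation of the code with all intermediate values
below a bound b. On an initial segment [0 .. M] of the natural numbers the
evaluation relations of all subcodes, for b = M + 1 and b = M, are determined by
first-order axioms, and so is the least M such that f converges on 0, ..., 2a
within the bound M + 1. This structure is coded by a graph in which [0 .. M] is a
clique. The element 2a is named by a formula of depth a + O(1), so the whole
description has depth at most a + C; taking a = C gives a graph F with
D_EMSO1[F] <= 2a and D[F] > M >= f(j) for all j <= 2a. *)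

Set Implicit Arguments.
Unset Strict Implicit.
Unset Printing Implicit Defensive.

Lemma contains_inducedP (F G : sgraph) :
  contains_induced F G <->
  exists2 g : F -> G, injective g & forall x y, adj (g x) (g y) = adj x y.
Proof.
split=> [[S [f [[f' fK f'K] f_adj]]]|[g g_inj g_adj]].
  exists (fun x => val (f' x)) => [x y /val_inj|x y]; first exact: can_inj f'K _ _.
  by rewrite -[in RHS](f'K x) -[in RHS](f'K y) f_adj.
exists [set g x | x : F].
have gP (u : induced [set g x | x : F]) : exists x : F, g x == val u.
  by have /imsetP[x _ ux] := valP u; exists x; apply/eqP.
pose f u := xchoose (gP u).
have fK u : g (f u) = val u by apply/eqP; apply: (xchooseP (gP u)).
exists f; split; last by move=> u v; rewrite -g_adj !fK.
exists (fun x => Sub (g x) (imset_f g (isT : x \in F))) => [u|x].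
  by apply: val_inj; rewrite /= fK.
by apply: g_inj; rewrite fK.
Qed.

(** * Quantifier depth is at least the clique number *)

Section ColoredProduct.
Variables (F : sgraph) (c : nat).

Definition cprod_adj : rel ('I_c * F) :=
  fun u v => (u.1 != v.1) && adj u.2 v.2.

Lemma cprod_sym : symmetric cprod_adj.
Proof. by move=> u v; rewrite /cprod_adj eq_sym adj_sym. Qed.

Lemma cprod_irrefl : irreflexive cprod_adj.
Proof. by move=> u; rewrite /cprod_adj eqxx. Qed.

Definition cprod : sgraph := SGraph cprod_sym cprod_irrefl.

End ColoredProduct.

Lemma fresh_color c n (e : n.-tuple 'I_c) : n < c -> exists x, x \notin e.
Proof.
move=> nc; apply/existsP; rewrite -negb_forall; apply/negP => /forallP h.
have : #|'I_c| <= size e.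
  by apply: leq_trans (card_size e); apply/subset_leq_card/subsetP => x _.
by rewrite card_ord size_tuple leqNgt nc.
Qed.

Section ColoredGame.
Variable F : sgraph.

(** The invariant of the game. Atomic formulas see colours only through equality, so only the
    pattern of equal colours has to be preserved. *)
Definition same_colors c1 c2 n (e1 : n.-tuple (cprod F c1))
    (e2 : n.-tuple (cprod F c2)) :=
  (forall i, (tnth e1 i).2 = (tnth e2 i).2) /\
  (forall i j, ((tnth e1 i).1 == (tnth e1 j).1) =
               ((tnth e2 i).1 == (tnth e2 j).1)).

Lemma same_colors_sym c1 c2 n (e1 : n.-tuple (cprod F c1))
    (e2 : n.-tuple (cprod F c2)) :
  same_colors e1 e2 -> same_colors e2 e1.
Proof. by case=> h1 h2; split=> [i|i j]; rewrite ?h1 ?h2. Qed.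

(* Duplicator copies the coordinate in F and answers colours consistently. *)
Lemma same_colors_extend c1 c2 n (e1 : n.-tuple (cprod F c1))
    (e2 : n.-tuple (cprod F c2)) (x : cprod F c1) :
  n < c2 -> same_colors e1 e2 ->
  exists y, same_colors [tuple of x :: e1] [tuple of y :: e2].
Proof.
move=> nc [h1 h2].
suff [k hk] : exists k, forall i, (x.1 == (tnth e1 i).1) = (k == (tnth e2 i).1).
  exists (k, x.2); split=> [i|i j].
    by case: (unliftP ord0 i) => [i' ->|->]; rewrite ?tnthS ?tnth0.
  case: (unliftP ord0 i) => [i' ->|->]; case: (unliftP ord0 j) => [j' ->|->];
  by rewrite ?tnthS ?tnth0 ?eqxx ?h2 ?hk // eq_sym hk eq_sym.
have [/existsP[i /eqP xi]|nx] := boolP [exists i, x.1 == (tnth e1 i).1].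
  by exists (tnth e2 i).1 => j; rewrite xi h2.
have [k hk] := @fresh_color c2 n [tuple (tnth e2 i).1 | i < n] nc.
move: nx; rewrite negb_exists => /forallP nx.
exists k => i; rewrite (negbTE (nx i)).
apply/esym/negbTE; apply: contra hk => /eqP ->.
by apply/tnthP; exists i; rewrite tnth_mktuple.
Qed.

(** Opening a quantifier leaves [n + qdepth p] unchanged, so at every move fewer elements than
    colours are in play on either side and a fresh colour remains. The equation [m = 0] excludes
    membership atoms. *)
Lemma cprod_equiv m n (p : fo m n) c1 c2 (X1 : m.-tuple {set cprod F c1})
    (X2 : m.-tuple {set cprod F c2}) (e1 : n.-tuple (cprod F c1))
    (e2 : n.-tuple (cprod F c2)) :
  m = 0 -> n + qdepth p <= c1 -> n + qdepth p <= c2 -> same_colors e1 e2 ->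
  sat X1 p e1 = sat X2 p e2.
Proof.
move=> m0; elim: p e1 e2 => {n} /=
  [n i j|n i j|n i j|n p IH|n p IHp q IHq|n p IHp q IHq|n p IH|n p IH] e1 e2 h1 h2.
- by case=> f1 f2; rewrite /cprod_adj /= f2 !f1.
- case=> f1 f2; move: (f2 i j) (f1 i) (f1 j).
  case: (tnth e1 i) (tnth e1 j) (tnth e2 i) (tnth e2 j).
  by move=> a b [a' b'] [c d] [c' d'] /= E -> ->; rewrite !xpair_eqE E.
- by subst m; case: j.
- by move=> se; rewrite (IH _ e2).
- by move=> se; rewrite (IHp _ e2) ?(IHq _ e2) //; lia.
- by move=> se; rewrite (IHp _ e2) ?(IHq _ e2) //; lia.
- move=> se; apply/existsP/existsP=> [[x hx]|[x hx]].
    have [|y hy] := same_colors_extend x _ se; first lia.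
    by exists y; rewrite -(IH [tuple of x :: e1]) //; lia.
  have [|y hy] := same_colors_extend x _ (same_colors_sym se); first lia.
  by exists y; rewrite (IH _ [tuple of x :: e2]) //; [lia|lia|exact: same_colors_sym].
- move=> se; apply/forallP/forallP=> hx x.
    have [|y hy] := same_colors_extend x _ (same_colors_sym se); first lia.
    by rewrite -(IH [tuple of y :: e1]) //; [lia|lia|exact: same_colors_sym].
  have [|y hy] := same_colors_extend x _ se; first lia.
  by rewrite (IH _ [tuple of y :: e2]) //; lia.
Qed.

Lemma depth_ge_clique s (k : 'I_s -> F) :
  (forall i j, i != j -> adj (k i) (k j)) -> s <= D F.
Proof.
move=> hk; rewrite /D; case: ex_minnP => d /asboolP[p [hp <-]] _ {d}.
rewrite leqNgt; apply/negP => lt_ps.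
(* Enough colours to give each vertex of [F] its own, and enough for a game of [qdepth p] rounds. *)
pose c := #|F| + qdepth p.
have /hp[X Xp] : contains_induced F (cprod F c).
  apply/contains_inducedP.
  exists (fun x => (lshift (qdepth p) (enum_rank x), x)) => [x y []//|x y].
  rewrite /= /cprod_adj /= (inj_eq (@lshift_inj _ _)) (inj_eq enum_rank_inj).
  by case: eqVneq => [->|]; rewrite ?adj_irrefl.
(* Since [qdepth p < s], already [s.-1] colours suffice for the game; but the copies of the [s]
   clique vertices need pairwise distinct colours. *)
have /hp/contains_inducedP[g _ g_adj] : models (cprod F s.-1) p.
  exists [tuple]; rewrite (@cprod_equiv _ _ p _ c _ X _ [tuple]) //; try lia.
  by split; case.
have col_inj : injective (fun i => (g (k i)).1).
  move=> i j ij; apply/eqP; apply: contraT => /hk.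
  by rewrite -g_adj /= /cprod_adj ij eqxx.
have := leq_card _ col_inj; rewrite !card_ord; lia.
Qed.

End ColoredGame.

(** * Bounded evaluation of recursive codes *)

(* Enumerates the pairs along antidiagonals. The step function uses only zero
   and successor, which makes both projections first-order axiomatizable over a
   finite linear order. *)
Fixpoint unpair (t : nat) : nat * nat :=
  if t is t'.+1 then
    let: (a, b) := unpair t' in
    if b is b'.+1 then (a.+1, b') else (0, a.+1)
  else (0, 0).

Definition pleft t := (unpair t).1.
Definition pright t := (unpair t).2.

Lemma pleftS t :
  pleft t.+1 = if pright t is 0 then 0 else (pleft t).+1.
Proof. by rewrite /pleft /pright /=; case: (unpair t) => a [|b]. Qed.

Lemma prightS t :
  pright t.+1 = if pright t is b.+1 then b else (pleft t).+1.
Proof. by rewrite /pleft /pright /=; case: (unpair t) => a [|b]. Qed.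

(** An initial segment that contains a code thus contains both of its components. *)
Lemma unpair_bound t : pleft t + pright t <= t.
Proof.
by elim: t => [|t IH] //; rewrite pleftS prightS; case: (pright t) IH => [|b]; lia.
Qed.

Lemma pleft_le t : pleft t <= t. Proof. have := unpair_bound t; lia. Qed.
Lemma pright_le t : pright t <= t. Proof. have := unpair_bound t; lia. Qed.

Lemma unpair_surj a b : exists t, pleft t = a /\ pright t = b.
Proof.
(* Induction on the antidiagonal, then along it: [(0, s + 1)] follows [(s, 0)], and [(a + 1, b)]
   follows [(a, b + 1)]. *)
move eqs: (a + b) => s; elim: s a b eqs => [|s IHs] a b.
  by case: a b => [|a] [|b] //= _; exists 0.
elim: a b => [|a IHa] b eqs.
  have [|t [l r]] := IHs s 0; first by rewrite addn0.
  by exists t.+1; rewrite pleftS prightS r l; split=> //; lia.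
have [|t [l r]] := IHa b.+1; first lia.
by exists t.+1; rewrite pleftS prightS r l.
Qed.

Definition entry i t := pleft (iter i pright t).

Lemma iter_pright_le i t : iter i pright t <= t.
Proof. by elim: i => //= i IH; apply: leq_trans (pright_le _) IH. Qed.

Lemma entryS i t : entry i.+1 t = entry i (pright t).
Proof. by rewrite /entry iterSr. Qed.

(** Vectors are nested pairs without an end marker: every number codes a vector of every length, and
    the last tail is ignored. *)
Definition vec n t : n.-tuple nat := [tuple entry i t | i < n].

Lemma vec_surj n (v : n.-tuple nat) : exists t, vec n t = v.
Proof.
elim: n v => [|n IH] v; first by exists 0; rewrite (tuple0 v) tuple0.
case/tupleP: v => x v; have [u hu] := IH v.
have [t [l r]] := unpair_surj x u; exists t.
apply: eq_from_tnth => i; rewrite tnth_mktuple.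
case: (unliftP ord0 i) => [j ->|->]; last by rewrite tnth0 -l.
by rewrite tnthS lift0 entryS r -hu tnth_mktuple.
Qed.

Lemma vec_cons n t : vec n.+1 t = [tuple of pleft t :: vec n (pright t)].
Proof.
apply: eq_from_tnth => i; rewrite tnth_mktuple.
case: (unliftP ord0 i) => [j ->|->]; last by rewrite tnth0.
by rewrite tnthS lift0 entryS tnth_mktuple.
Qed.

(** With [u] the vector coded by [pright t]: [t] codes [k :: u], [t'] codes [k' :: u], [z] is the
    previous value, and [s] codes the argument [k' :: z :: u] of the step function. *)
Fixpoint prec_ev (b : nat) (g h : nat -> nat -> Prop) (k t y : nat) : Prop :=
  match k with
  | 0 => pleft t = 0 /\ g (pright t) y
  | k'.+1 => pleft t = k'.+1 /\ exists t' z s,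
      [/\ t' < b, z < b & s < b] /\
      [/\ pright t' = pright t, prec_ev b g h k' t' z & h s y] /\
      [/\ pleft s = k', pleft (pright s) = z & pright (pright s) = pright t]
  end.

(* Evaluation on the vector coded by [t], all auxiliary codes and intermediate
   values being below [b]. *)
Fixpoint ev (b : nat) n (c : recf n) (t y : nat) : Prop :=
  match c with
  | Rzero _ => y = 0
  | Rsucc => y = (pleft t).+1
  | Rproj _ i => y = entry i t
  | Rcomp k _ g h =>
      exists w, [/\ w < b, forall i : 'I_k, ev b (h i) t (entry i w) & ev b g w y]
  | Rprec _ g h => prec_ev b (ev b g) (ev b h) (pleft t) t y
  | Rmu _ g =>
      (exists s, [/\ s < b, pleft s = y, pright s = t & ev b g s 0]) /\
      (forall z, z < y -> exists s k,
         [/\ s < b, k.+1 < b, pleft s = z, pright s = t & ev b g s k.+1])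
  end.

Lemma computes_Rprec n (g : recf n) (h : recf n.+2) x (u : n.-tuple nat) y :
  computes (Rprec g h) [tuple of x :: u] y =
  primrec_graph (computes g u) (fun k z => computes h [tuple of k :: z :: u]) x y.
Proof.
pose w := [tuple of behead [tuple of x :: u]].
have wu : w = u by apply: val_inj.
transitivity (primrec_graph (computes g w)
  (fun k z => computes h [tuple of k :: z :: w]) x y); first by [].
by rewrite wu.
Qed.

Lemma ev_sound b n (c : recf n) t y : ev b c t y -> computes c (vec n t) y.
Proof.
elim: c t y => {n} [n||n i|k n g IHg h IHh|n g IHg h IHh|n g IHg] t y //.
- by move=> ->; rewrite /= /thead tnth_mktuple.
- by move=> ->; rewrite /= tnth_mktuple.
- move=> /= [w [_ hw gw]]; exists (vec k w) => [i|]; last exact: IHg.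
  by rewrite tnth_mktuple; apply: IHh.
- rewrite vec_cons computes_Rprec; move hu: (vec n (pright t)) => u.
  rewrite /=; move: (pleft t) => k.
  elim: k t y u hu => [|k IHk] t y u hu /=; first by case=> _ /IHg; rewrite hu.
  case=> _ [t' [z [s [_ [[rt E1 E2] [l1 l2 l3]]]]]].
  exists z; first by apply: IHk E1; rewrite rt.
  by move/IHh: E2; rewrite !vec_cons l1 l2 l3 hu.
- case=> [[s [_ ls rs E]] h]; split.
    by move/IHg: E; rewrite vec_cons ls rs.
  move=> z /h[s' [k [_ _ ls' rs' E']]]; exists k.
  by move/IHg: E'; rewrite vec_cons ls' rs'.
Qed.

Lemma prec_ev_mono b b' (g g' h h' : nat -> nat -> Prop) k t y :
  b <= b' -> (forall t y, g t y -> g' t y) -> (forall t y, h t y -> h' t y) ->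
  prec_ev b g h k t y -> prec_ev b' g' h' k t y.
Proof.
move=> bb gg hh; elim: k t y => [|k IHk] t y /=; first by case=> -> /gg.
case=> -> [t' [z [s [[b1 b2 b3] [[rt /IHk E1 /hh E2] l]]]]].
by split=> //; exists t', z, s; split=> //; split; apply: leq_trans bb.
Qed.

Lemma ev_mono b b' n (c : recf n) t y : b <= b' -> ev b c t y -> ev b' c t y.
Proof.
move=> bb; elim: c t y => {n} [n||n i|k n g IHg h IHh|n g IHg h IHh|n g IHg] t y //=.
- case=> w [wb hw gw]; exists w; split; [exact: leq_trans bb| |exact: IHg].
  by move=> i; apply: IHh.
- exact: prec_ev_mono.
- case=> [[s [sb ls rs E]] h]; split.
    by exists s; split=> //; [apply: leq_trans bb|apply: IHg].
  move=> z /h[s' [k [sb' kb ls' rs' E']]]; exists s', k.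
  by split=> //; [apply: leq_trans bb|apply: leq_trans bb|apply: IHg].
Qed.

Lemma uniform_bound (P : nat -> nat -> Prop) N :
  (forall i b b', b <= b' -> P i b -> P i b') ->
  (forall i, i < N -> exists b, P i b) -> exists b, forall i, i < N -> P i b.
Proof.
move=> mono; elim: N => [|N IH] h; first by exists 0.
have [|b hb] := IH; first by move=> i /leqW/h.
have [b' hb'] := h N (leqnn _).
exists (maxn b b') => i; rewrite ltnS leq_eqVlt => /orP[/eqP->|/hb].
  by apply: mono hb'; rewrite leq_maxr.
by apply: mono; rewrite leq_maxl.
Qed.

(** A converging computation involves finitely many codes and values; [b] is a maximum exceeding
    them all, and [ev_mono] lifts the bounds of the subcomputations to it. *)
Lemma ev_complete n (c : recf n) t y :
  computes c (vec n t) y -> exists b, ev b c t y.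
Proof.
elim: c t y => {n} [n||n i|k n g IHg h IHh|n g IHg h IHh|n g IHg] t y.
- by exists 0.
- by move=> /= ->; exists 0; rewrite /thead tnth_mktuple.
- by move=> /= ->; exists 0; rewrite tnth_mktuple.
- case=> v hv gv; have [w hw] := vec_surj v.
  have [||b1 h1] := @uniform_bound
    (fun j b => forall i : 'I_k, i = j :> nat -> ev b (h i) t (entry i w)) k.
  + by move=> j b b' bb H i ij; apply: ev_mono (H _ ij).
  + move=> j jk; have [|b Hb] := IHh (Ordinal jk) t (entry j w).
      by move: (hv (Ordinal jk)); rewrite -hw tnth_mktuple.
    by exists b => i ij; have -> : i = Ordinal jk by apply: val_inj.
  have [|b2 h2] := IHg w y; first by rewrite hw.
  exists (maxn w.+1 (maxn b1 b2)), w; split.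
  + by rewrite leq_maxl.
  + move=> i; apply: ev_mono (h1 i (ltn_ord i) i erefl); lia.
  + by apply: ev_mono h2; lia.
- rewrite vec_cons computes_Rprec; move hu: (vec n (pright t)) => u.
  rewrite /=; move def_k: (pleft t) => k.
  elim: k t y u hu def_k => [|k IHk] t y u hu kt /=.
    by rewrite -hu => /IHg[b Hb]; exists b.
  case=> z zE hE; have [t' [lt' rt']] := unpair_surj k (pright t).
  have [|b1 h1] := IHk t' z u _ lt' zE; first by rewrite rt'.
  have [q [lq rq]] := unpair_surj z (pright t).
  have [s [ls rs]] := unpair_surj k q.
  have [|b2 h2] := IHh s y; first by rewrite !vec_cons ls rs lq rq hu.
  exists (maxn (maxn t'.+1 (maxn z.+1 s.+1)) (maxn b1 b2)); split=> //.
  exists t', z, s; split; first by split; lia.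
  split; last by rewrite ls rs.
  split=> //; last by apply: ev_mono h2; lia.
  by apply: prec_ev_mono h1 => [|t0 y0|t0 y0]; [lia| |]; apply: ev_mono; lia.
- case=> h0 hz; have [s [ls rs]] := unpair_surj y t.
  have [|b1 h1] := IHg s 0; first by rewrite vec_cons ls rs.
  have [||b2 h2] := @uniform_bound (fun z b => exists s k,
    [/\ s < b, k.+1 < b, pleft s = z, pright s = t & ev b g s k.+1]) y.
  + move=> z b b' bb [s' [k [p1 p2 p3 p4 p5]]]; exists s', k; split=> //.
    * exact: leq_trans bb.
    * exact: leq_trans bb.
    * exact: ev_mono p5.
  + move=> z /hz[k hk]; have [s' [ls' rs']] := unpair_surj z t.
    have [|b Hb] := IHg s' k.+1; first by rewrite vec_cons ls' rs'.
    exists (maxn b (maxn s'.+1 k.+2)), s', k; split=> //; try lia.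
    by apply: ev_mono Hb; lia.
  exists (maxn s.+1 (maxn b1 b2)); split.
    by exists s; split=> //; [lia|apply: ev_mono h1; lia].
  move=> z /h2[s' [k [p1 p2 p3 p4 p5]]]; exists s', k; split=> //; try lia.
  by apply: ev_mono p5; lia.
Qed.

(** * First-order definability over structures with binary relations *)

(* De Bruijn formulas in a language with binary relation symbols indexed by nat;
   quantifiers are relativized to a domain predicate. *)
Inductive nf : Type :=
| NRel of nat & nat & nat
| NEq of nat & nat
| NNeg of nf
| NAnd of nf & nf
| NEx of nf.

Fixpoint ndepth (p : nf) : nat :=
  match p with
  | NRel _ _ _ | NEq _ _ => 0
  | NNeg p => ndepth p
  | NAnd p q => maxn (ndepth p) (ndepth q)
  | NEx p => (ndepth p).+1
  end.

Definition scons A (x : A) (e : nat -> A) (i : nat) : A :=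
  if i is i'.+1 then e i' else x.

Definition stail A (e : nat -> A) (i : nat) : A := e i.+1.

Fixpoint nsem A (D : A -> Prop) (S : nat -> A -> A -> Prop) (p : nf)
    (e : nat -> A) : Prop :=
  match p with
  | NRel r i j => S r (e i) (e j)
  | NEq i j => e i = e j
  | NNeg p => ~ nsem D S p e
  | NAnd p q => nsem D S p e /\ nsem D S q e
  | NEx p => exists x, D x /\ nsem D S p (scons x e)
  end.

Lemma nsem_iso A B (DA : A -> Prop) (DB : B -> Prop) SA SB (f : A -> B) p e e' :
  (forall x, DA x -> DB (f x)) ->
  (forall y, DB y -> exists2 x, DA x & f x = y) ->
  (forall x y, DA x -> DA y -> f x = f y -> x = y) ->
  (forall r x y, DA x -> DA y -> (SA r x y <-> SB r (f x) (f y))) ->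
  (forall i, DA (e i)) -> (forall i, f (e i) = e' i) ->
  (nsem DA SA p e <-> nsem DB SB p e').
Proof.
move=> fD fsurj finj fS; elim: p e e' => [r i j|i j|p IH|p IHp q IHq|p IH] e e' De ee /=.
- by rewrite -!ee; apply: fS.
- by rewrite -!ee; split=> [->|] //; apply: finj.
- by rewrite (IH e e').
- by rewrite (IHp e e') // (IHq e e').
- have step x : DA x -> (nsem DA SA p (scons x e) <-> nsem DB SB p (scons (f x) e')).
    by move=> Dx; apply: IH => -[|i] /=.
  split=> [[x [Dx /(step _ Dx) h]]|[y [/fsurj[x Dx <-] /(step _ Dx) h]]].
    by exists (f x); split=> //; apply: fD.
  by exists x.
Qed.

Definition npred :=
  forall A : Type, (A -> Prop) -> (nat -> A -> A -> Prop) -> (nat -> A) -> Prop.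

(** A semantic notion: predicates are written directly as propositions, and the closure lemmas
    certify that they are first-order, so no formula has to be spelled out. *)
Definition ndef (d : nat) (P : npred) : Prop :=
  exists2 p, ndepth p <= d & forall A D S e, @nsem A D S p e <-> P A D S e.

(** For the parts of the description whose depth is a constant, whatever its value. *)
Definition fodef (P : npred) : Prop := exists d, ndef d P.

Lemma ndef_leq d d' P : d <= d' -> ndef d P -> ndef d' P.
Proof. by move=> dd [p hp h]; exists p => //; apply: leq_trans dd. Qed.

Lemma fodef2 (P Q R : npred) :
  (forall d, ndef d P -> ndef d Q -> ndef d R) -> fodef P -> fodef Q -> fodef R.
Proof.
move=> h [d1 h1] [d2 h2]; exists (maxn d1 d2).
by apply: h; [apply: ndef_leq h1|apply: ndef_leq h2]; rewrite ?leq_maxl ?leq_maxr.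
Qed.

Lemma ndef_iff d (P Q : npred) :
  (forall A D S e, P A D S e <-> Q A D S e) -> ndef d P -> ndef d Q.
Proof. by move=> PQ [p hp h]; exists p => // A D S e; rewrite h. Qed.

Lemma ndef_not d (P : npred) :
  ndef d P -> ndef d (fun A D S e => ~ P A D S e).
Proof. by case=> p hp h; exists (NNeg p) => //= A D S e; rewrite h. Qed.

Lemma ndef_and d (P Q : npred) :
  ndef d P -> ndef d Q -> ndef d (fun A D S e => P A D S e /\ Q A D S e).
Proof.
case=> p hp h [q hq h']; exists (NAnd p q) => /= [|A D S e]; last by rewrite h h'.
by rewrite geq_max hp.
Qed.

Lemma ndef_ex_scons d (P : npred) :
  ndef d P -> ndef d.+1 (fun A D S e => exists x, D x /\ P A D S (scons x e)).
Proof.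
case=> p hp h; exists (NEx p) => //= A D S e.
by split=> -[x [Dx /h hx]]; exists x.
Qed.

(** The bound variable becomes a separate argument, so that the lemma applies to quantifiers as they
    are naturally written; under the binder it is index 0 and [stail] recovers the old
    environment. *)
Lemma ndef_ex d (P : forall A : Type, (A -> Prop) -> (nat -> A -> A -> Prop) ->
    (nat -> A) -> A -> Prop) :
  ndef d (fun A D S e => P A D S (stail e) (e 0)) ->
  ndef d.+1 (fun A D S e => exists x, D x /\ P A D S e x).
Proof. exact: ndef_ex_scons. Qed.

Lemma ndef_rename d (P : npred) (f : nat -> nat) : ndef d P ->
  ndef d (fun A D S e => P A D S (fun i => e (f i))).
Proof.
case=> p pd hp.
suff [q qd hq] : exists2 q, ndepth q = ndepth p &
    forall A D S e, @nsem A D S q e <-> nsem D S p (fun i => e (f i)).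
  by exists q; rewrite ?qd // => A D S e; rewrite hq hp.
elim: p f {pd hp} => [r i j|i j|p IH|p IHp q IHq|p IH] f.
- by exists (NRel r (f i) (f j)).
- by exists (NEq (f i) (f j)).
- by have [q qd hq] := IH f; exists (NNeg q) => //= A D S e; rewrite hq.
- have [p' pd hp] := IHp f; have [q' qd hq] := IHq f.
  by exists (NAnd p' q') => [/=|/= A D S e]; rewrite ?pd ?qd ?hp ?hq.
- have [q qd hq] := IH (fun i => if i is i'.+1 then (f i').+1 else 0).
  exists (NEx q) => [/=|/= A D S e]; first by rewrite qd.
  have E x : (fun i => scons x e (if i is i'.+1 then (f i').+1 else 0)) =
             scons x (fun i => e (f i)) by apply/funext => -[].
  split=> -[x [Dx h]]; exists x; split=> //.
    by move/hq: h; rewrite E.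
  by apply/hq; rewrite E.
Qed.

Lemma fodef_rel r i j : fodef (fun A D S e => S r (e i) (e j)).
Proof. by exists 0, (NRel r i j). Qed.

Lemma fodef_eq i j : fodef (fun A D S e => e i = e j).
Proof. by exists 0, (NEq i j). Qed.

Lemma fodef_iff (P Q : npred) :
  (forall A D S e, P A D S e <-> Q A D S e) -> fodef P -> fodef Q.
Proof. by move=> PQ [d h]; exists d; apply: ndef_iff h. Qed.

Lemma fodef_not (P : npred) : fodef P -> fodef (fun A D S e => ~ P A D S e).
Proof. by case=> d h; exists d; apply: ndef_not. Qed.

Lemma fodef_and (P Q : npred) :
  fodef P -> fodef Q -> fodef (fun A D S e => P A D S e /\ Q A D S e).
Proof. by apply: fodef2 => d; apply: ndef_and. Qed.

Lemma fodef_or (P Q : npred) :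
  fodef P -> fodef Q -> fodef (fun A D S e => P A D S e \/ Q A D S e).
Proof.
move=> hP hQ; apply: fodef_iff (fodef_not (fodef_and (fodef_not hP) (fodef_not hQ))).
by move=> A D S e; rewrite not_andE !notE.
Qed.

Lemma fodef_imp (P Q : npred) :
  fodef P -> fodef Q -> fodef (fun A D S e => P A D S e -> Q A D S e).
Proof.
move=> hP hQ; apply: fodef_iff (fodef_or (fodef_not hP) hQ).
by move=> A D S e; rewrite implyE.
Qed.

Lemma fodef_equiv (P Q : npred) :
  fodef P -> fodef Q -> fodef (fun A D S e => P A D S e <-> Q A D S e).
Proof. by move=> hP hQ; apply: fodef_and; apply: fodef_imp. Qed.

Lemma fodef_ex (P : forall A : Type, (A -> Prop) -> (nat -> A -> A -> Prop) ->
    (nat -> A) -> A -> Prop) :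
  fodef (fun A D S e => P A D S (stail e) (e 0)) ->
  fodef (fun A D S e => exists x, D x /\ P A D S e x).
Proof. by case=> d h; exists d.+1; apply: ndef_ex. Qed.

Lemma fodef_all (P : forall A : Type, (A -> Prop) -> (nat -> A -> A -> Prop) ->
    (nat -> A) -> A -> Prop) :
  fodef (fun A D S e => P A D S (stail e) (e 0)) ->
  fodef (fun A D S e => forall x, D x -> P A D S e x).
Proof.
move=> h; have := fodef_not (@fodef_ex (fun A D S e x => ~ P A D S e x) (fodef_not h)).
apply: fodef_iff => A D S e.
split=> [H x Dx|H [x [Dx nP]]]; last exact: nP (H x Dx).
by apply: contrapT => nP; apply: H; exists x.
Qed.

(** Admits conditions of the metatheory inside a formula, such as an equation between sort
    indices. *)
Lemma fodef_const (b : Prop) : fodef (fun _ _ _ _ => b).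
Proof.
have [hb|hb] := EM b; first by apply: fodef_iff (fodef_eq 0 0) => A D S e.
by apply: fodef_iff (fodef_not (fodef_eq 0 0)) => A D S e; split=> // /(_ erefl).
Qed.

Lemma fodef_forall_ord k (P : 'I_k -> npred) : 0 < k ->
  (forall i, fodef (P i)) -> fodef (fun A D S e => forall i, P i A D S e).
Proof.
move=> k_gt0 h; pose i0 := Ordinal k_gt0.
suff H n : n <= k -> fodef (fun A D S e => forall i : 'I_k, i < n -> P i A D S e).
  apply: fodef_iff (H k (leqnn _)) => A D S e.
  by split=> Hi i; [apply: Hi|move=> _; apply: Hi].
elim: n => [_|n IH nk].
  apply: fodef_iff (fodef_or (h i0) (fodef_not (h i0))) => A D S e.
  by split=> // _; apply: EM.
apply: fodef_iff (fodef_and (IH (ltnW nk)) (h (Ordinal nk))) => A D S e.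
split=> [[H1 H2] i|H].
  rewrite ltnS leq_eqVlt => /orP[/eqP Ei|]; last exact: H1.
  by have -> : i = Ordinal nk by apply: val_inj.
by split=> [i lin|]; apply: H => //; apply: ltnW.
Qed.

(** Used to move between the marked part of a graph and [[0 .. M]]; [f] has to be an isomorphism
    between the two domains only. *)
Lemma fodef_iso A B (DA : A -> Prop) (DB : B -> Prop) SA SB (f : A -> B) P e e' :
  fodef P ->
  (forall x, DA x -> DB (f x)) ->
  (forall y, DB y -> exists2 x, DA x & f x = y) ->
  (forall x y, DA x -> DA y -> f x = f y -> x = y) ->
  (forall r x y, DA x -> DA y -> (SA r x y <-> SB r (f x) (f y))) ->
  (forall i, DA (e i)) -> (forall i, f (e i) = e' i) ->
  (P A DA SA e <-> P B DB SB e').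
Proof.
move=> [d [p _ hp]] h1 h2 h3 h4 h5 h6; rewrite -!hp; exact: nsem_iso h6.
Qed.

Ltac fodef_step := cbv beta delta [stail]; first
  [ assumption
  | apply fodef_rel | apply fodef_eq
  | apply fodef_ex | apply fodef_all
  | apply fodef_and | apply fodef_or | apply fodef_not
  | apply fodef_equiv | apply fodef_imp ].
Ltac fodef_auto := repeat fodef_step.

(* Symbol 0 is the order, symbols 1 and 2 the projections of the pairing. *)
Section Vocabulary.
Variables (A : Type) (D : A -> Prop) (S : nat -> A -> A -> Prop).

Definition zeroP x := forall z, D z -> ~ S 0 z x.

Definition succP x y := S 0 x y /\ forall z, D z -> ~ (S 0 x z /\ S 0 z y).

Fixpoint entryP i x z :=
  if i is i'.+1 then exists p, D p /\ (S 2 p x /\ entryP i' p z) else S 1 z x.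

(** The recursion of [unpair] along successors, split by whether the right component [b] of [t] is
    zero. Components come first: [S 1 a t] says that [a] is the left component of [t]. *)
Definition pairing_axiom :=
  (forall t, D t -> zeroP t ->
     forall i, D i -> (S 1 i t <-> zeroP i) /\ (S 2 i t <-> zeroP i)) /\
  (forall t, D t -> forall t', D t' -> succP t t' ->
   forall a, D a -> S 1 a t -> forall b, D b -> S 2 b t -> forall i, D i ->
     (zeroP b -> (S 1 i t' <-> zeroP i) /\ (S 2 i t' <-> succP a i)) /\
     (forall b', D b' -> succP b' b ->
        (S 1 i t' <-> succP a i) /\ (S 2 i t' <-> i = b'))).

End Vocabulary.

Lemma fodef_zero i : fodef (fun A D S e => zeroP D S (e i)).
Proof. by rewrite /zeroP; fodef_auto. Qed.

Lemma fodef_succ i j : fodef (fun A D S e => succP D S (e i) (e j)).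
Proof. by rewrite /succP; fodef_auto. Qed.

Lemma fodef_entry k i j : fodef (fun A D S e => entryP D S k (e i) (e j)).
Proof.
elim: k i j => [|k IH] i j /=; first exact: fodef_rel.
by apply: fodef_ex; apply: fodef_and; [exact: fodef_rel|exact: IH].
Qed.

Ltac fodef_step ::= cbv beta delta [stail]; first
  [ assumption
  | apply fodef_zero | apply fodef_succ | apply fodef_entry
  | apply fodef_rel | apply fodef_eq
  | apply fodef_ex | apply fodef_all
  | apply fodef_and | apply fodef_or | apply fodef_not
  | apply fodef_equiv | apply fodef_imp ].

Lemma fodef_pairing : fodef (fun A D S _ => pairing_axiom D S).
Proof. by rewrite /pairing_axiom; fodef_auto. Qed.

(** * Order and pairing axioms on initial segments of the natural numbers *)

Definition upto (M x : nat) : Prop := x <= M.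

Section NatVocabulary.
Variables (M : nat) (S : nat -> nat -> nat -> Prop).

Definition ordered := forall i j, i <= M -> j <= M -> (S 0 i j <-> i < j).

Hypothesis S0 : ordered.

Lemma zeroP_nat x : x <= M -> (zeroP (upto M) S x <-> x = 0).
Proof.
move=> xM; split=> [h|-> z zM]; last by rewrite S0.
by case: x xM h => // x xM /(_ 0 isT); rewrite S0.
Qed.

Lemma succP_nat x y : x <= M -> y <= M -> (succP (upto M) S x y <-> y = x.+1).
Proof.
move=> xM yM; rewrite /succP S0 //; split=> [[xy h]|Ey].
  apply/eqP; rewrite eqn_leq xy andbT leqNgt; apply/negP => xy'.
  by apply: (h x.+1 (leq_trans xy yM)); rewrite !S0 ?(leq_trans xy yM).
by rewrite Ey in yM *; split=> // z zM; rewrite (S0 xM zM) (S0 zM yM); lia.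
Qed.

Lemma pairing_nat : pairing_axiom (upto M) S <->
  forall i j, i <= M -> j <= M ->
    (S 1 i j <-> i = pleft j) /\ (S 2 i j <-> i = pright j).
Proof.
split=> [[h0 hS] i j|h]; last first.
  split=> [t tM /(zeroP_nat tM) -> i iM|]; first by rewrite zeroP_nat //; apply: h.
  move=> t tM t' tM' /(succP_nat tM tM') Et a aM /(proj1 (h a t aM tM)) Ea.
  move=> b bM /(proj2 (h b t bM tM)) Eb i iM.
  have [E1 E2] := h i t' iM tM'.
  split=> [/(zeroP_nat bM) b0|b' bM' /(succP_nat bM' bM) bS]; rewrite E1 E2.
    by rewrite zeroP_nat // succP_nat // Et pleftS prightS -Ea -Eb b0.
  by rewrite succP_nat // Et pleftS prightS -Ea -Eb bS.
elim: j i => [|j IH] i iM jM.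
  by have := h0 0 jM (proj2 (zeroP_nat jM) erefl) i iM; rewrite zeroP_nat.
have jM' := ltnW jM.
(* Both components of [j] lie in the domain, so the successor axiom may be instantiated at them. *)
have lM := leq_trans (pleft_le j) jM'; have rM := leq_trans (pright_le j) jM'.
have := hS j jM' j.+1 jM (proj2 (succP_nat jM' jM) erefl)
  (pleft j) lM (proj2 (proj1 (IH _ lM jM')) erefl)
  (pright j) rM (proj2 (proj2 (IH _ rM jM')) erefl) i iM.
rewrite pleftS prightS; case: (pright j) rM => [|b] rM [H1 H2].
  have [] := H1 (proj2 (zeroP_nat rM) erefl).
  by rewrite zeroP_nat // succP_nat.
have [] := H2 b (ltnW rM) (proj2 (succP_nat (ltnW rM) rM) erefl).
by rewrite succP_nat.
Qed.

End NatVocabulary.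

(** * Axiomatizable families of relations on initial segments *)

Definition agree o M (S T : nat -> nat -> nat -> Prop) :=
  forall r i j, r < o -> i <= M -> j <= M -> (S r i j <-> T r i j).

(* [sstd s M r] is the intended interpretation on [0 .. M] of the symbol
   [r < so s]. *)
Record sys := Sys { so : nat; sstd : nat -> nat -> nat -> nat -> Prop }.

(** One formula serves all [M]: once symbol 0 is the order of [[0 .. M]], it forces every symbol of
    the system to its intended meaning there. *)
Definition axiomatized (s : sys) :=
  exists2 P, fodef P &
    forall M S e, ordered M S -> (P nat (upto M) S e <-> agree (so s) M S (sstd s M)).

Definition sys_ok (s : sys) := [/\ 2 < so s,
  forall M i j, sstd s M 0 i j <-> i < j,
  forall M i j, sstd s M 1 i j <-> i = pleft j,
  forall M i j, sstd s M 2 i j <-> i = pright j & axiomatized s].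

Definition ext (s s' : sys) :=
  so s <= so s' /\ forall M r, r < so s -> sstd s' M r = sstd s M r.

Lemma ext_trans s1 s2 s3 : ext s1 s2 -> ext s2 s3 -> ext s1 s3.
Proof.
move=> [o12 h12] [o23 h23]; split=> [|M r ro]; first exact: leq_trans o23.
by rewrite h23 ?h12 //; apply: leq_trans o12.
Qed.

Definition base_sys : sys := Sys 3 (fun _ r i j =>
  match r with 0 => i < j | 1 => i = pleft j | _ => i = pright j end).

Lemma base_sys_ok : sys_ok base_sys.
Proof.
split=> //; exists (fun A D S _ => pairing_axiom D S); first exact: fodef_pairing.
move=> M S e S0; rewrite (pairing_nat S0); split=> h.
  case=> [|[|[|//]]] i j _ iM jM /=; first exact: S0.
    by have [] := h _ _ iM jM.
  by have [] := h _ _ iM jM.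
by move=> i j iM jM; split; [apply: (h 1)|apply: (h 2)].
Qed.

Section SysFacts.
Variables (s : sys) (M : nat) (S : nat -> nat -> nat -> Prop).
Hypotheses (s_ok : sys_ok s) (Sa : agree (so s) M S (sstd s M)).

Lemma agree_ordered : ordered M S.
Proof. by case: s_ok => o3 h0 _ _ _ i j iM jM; rewrite Sa // ?h0 //; lia. Qed.

Lemma agree_left i j : i <= M -> j <= M -> (S 1 i j <-> i = pleft j).
Proof. by case: s_ok => o3 _ h _ _ iM jM; rewrite Sa // ?h //; lia. Qed.

Lemma agree_right i j : i <= M -> j <= M -> (S 2 i j <-> i = pright j).
Proof. by case: s_ok => o3 _ _ h _ iM jM; rewrite Sa // ?h //; lia. Qed.

Lemma agree_zero x : x <= M -> (zeroP (upto M) S x <-> x = 0).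
Proof. exact: zeroP_nat agree_ordered _. Qed.

Lemma agree_succ x y : x <= M -> y <= M -> (succP (upto M) S x y <-> y = x.+1).
Proof. exact: succP_nat agree_ordered _ _. Qed.

Lemma agree_entry k x z :
  x <= M -> z <= M -> (entryP (upto M) S k x z <-> z = entry k x).
Proof.
elim: k x z => [|k IH] x z xM zM /=; first exact: agree_left.
rewrite entryS; split=> [[p [pM [/agree_right -> //]]]|->].
  by move/IH; apply=> //; apply: leq_trans xM; apply: pright_le.
have rM := leq_trans (pright_le x) xM.
exists (pright x); split=> //; split; first exact/agree_right.
apply/IH => //; apply: leq_trans rM; apply: leq_trans (iter_pright_le k _).
exact: pleft_le.
Qed.

End SysFacts.

(** [Q] may mention the new symbol [so s] itself, so the added axiom can be a recursive equation;
    the hypothesis asks that [new] be its only solution on [[0 .. M]]. *)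
Lemma add_relation s (Q : npred) (new : nat -> nat -> nat -> Prop) :
  sys_ok s -> fodef Q ->
  (forall M S e, agree (so s) M S (sstd s M) ->
     ((forall i j, i <= M -> j <= M ->
         (S (so s) i j <-> Q nat (upto M) S (scons i (scons j e)))) <->
      (forall i j, i <= M -> j <= M -> (S (so s) i j <-> new M i j)))) ->
  exists s', [/\ sys_ok s', ext s s', so s < so s' &
                 forall M, sstd s' M (so s) = new M].
Proof.
move=> ok [d Qd] hQ; have [o3 h0 h1 h2 [P Pd hP]] := ok.
pose s' := Sys (so s).+1
  (fun M r => if r < so s then sstd s M r else new M).
have ext_s : ext s s' by split=> //= M r ->.
exists s'; split=> //=; last by move=> M; rewrite ltnn.
split=> //=; first exact: ltnW.
- by rewrite (leq_trans _ o3).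
- by rewrite (leq_trans _ o3).
- by rewrite o3.
exists (fun A D S e => P A D S e /\
  forall y, D y -> forall t, D t ->
    (S (so s) t y <-> Q A D S (scons t (scons y e)))).
  apply: fodef_and => //; do 2 apply: fodef_all; apply: fodef_equiv.
    exact: fodef_rel.
  by exists d; case: Qd => p pd hp; exists p => // A D S e; rewrite hp;
    have -> : e = scons (e 0) (scons (e 1) (stail (stail e)))
      by apply/funext => -[|[|i]].
move=> M S e S0; rewrite hP //; split=> [[Sa h]|Sa'].
  have /hQ-/(_ e)[h' _] := Sa.
  move=> r i j /=; rewrite ltnS leq_eqVlt => /orP[/eqP -> iM jM|ro iM jM].
    by rewrite ltnn; apply: h' => // i' j' iM' jM'; apply: h.
  by rewrite ro; apply: Sa.
have Sa : agree (so s) M S (sstd s M).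
  by move=> r i j ro iM jM; rewrite Sa' //= ?ro // ltnW.
split=> // y yM t tM; apply: (proj2 (hQ M S e Sa)) => // i j iM jM.
by rewrite Sa' //= ltnn.
Qed.

(** The non-recursive case: [Q] evaluates to [new] however the new symbol is interpreted. *)
Lemma add_explicit s (Q : npred) (new : nat -> nat -> nat -> Prop) :
  sys_ok s -> fodef Q ->
  (forall M S e i j, agree (so s) M S (sstd s M) -> i <= M -> j <= M ->
     (Q nat (upto M) S (scons i (scons j e)) <-> new M i j)) ->
  exists s', [/\ sys_ok s', ext s s', so s < so s' &
                 forall M, sstd s' M (so s) = new M].
Proof.
move=> ok Qd h; apply: add_relation ok Qd _ => M S e Sa.
by split=> H i j iM jM; rewrite H // h.
Qed.

(** * First-order axiomatization of bounded evaluation *)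

Lemma ext_ok_lt s s' r : ext s s' -> r < so s -> r < so s'.
Proof. by case=> o _ ro; apply: leq_trans o. Qed.

(** The type of a definable guard that means [x < bd M] on [[0 .. M]]. The compilation is generic in
    the guard because each code is needed with two bounds, [M + 1] and [M]. *)
Definition epred :=
  forall A : Type, (A -> Prop) -> (nat -> A -> A -> Prop) -> A -> Prop.

Section Compile.
Variable Gd : epred.
Variable bd : nat -> nat.
Hypothesis Gd_def : forall i, fodef (fun A D S e => Gd D S (e i)).
Hypothesis bd_le : forall M, bd M <= M.+1.
Hypothesis Gd_nat : forall M S x, ordered M S -> x <= M ->
  (Gd (upto M) S x <-> x < bd M).

Definition realizes s r n (c : recf n) := r < so s /\
  forall M i j, i <= M -> j <= M -> (sstd s M r i j <-> ev (bd M) c i j).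

Lemma realizes_ext s s' r n (c : recf n) :
  ext s s' -> realizes s r c -> realizes s' r c.
Proof.
move=> E [ro h]; split=> [|M i j iM jM]; first exact: ext_ok_lt ro.
by case: E => _ ->; [apply: h|].
Qed.

Lemma realizes_agree s r n (c : recf n) M S i j : realizes s r c ->
  agree (so s) M S (sstd s M) -> i <= M -> j <= M ->
  (S r i j <-> ev (bd M) c i j).
Proof. by case=> ro h Sa iM jM; rewrite Sa // h. Qed.

Ltac gd_step := first [ apply Gd_def | fodef_step ].

(** Witnesses of bounded evaluation are elements of the domain, hence within reach of its
    quantifiers. *)
Lemma below M x : x < bd M -> x <= M.
Proof. by move=> h; have := bd_le M; lia. Qed.

Lemma entry_le M k x : x <= M -> entry k x <= M.
Proof.
move=> xM; apply: leq_trans xM; apply: leq_trans (iter_pright_le k _).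
exact: pleft_le.
Qed.

Lemma compile_zero n s : sys_ok s ->
  exists s' r, [/\ sys_ok s', ext s s' & realizes s' r (Rzero n)].
Proof.
move=> ok; pose Q : npred := fun A D S e => zeroP D S (e 1).
have Qd : fodef Q by rewrite /Q; fodef_auto.
have [|s' [ok' E o' h]] := @add_explicit s Q (fun M => ev (bd M) (Rzero n)) ok Qd.
  by move=> M S e i j Sa iM jM; rewrite /Q /= (agree_zero ok Sa).
by exists s', (so s); split=> //; split=> // M i j _ _; rewrite h.
Qed.

Lemma compile_succ s : sys_ok s ->
  exists s' r, [/\ sys_ok s', ext s s' & realizes s' r Rsucc].
Proof.
move=> ok.
pose Q : npred := fun A D S e => exists a, D a /\ (S 1 a (e 0) /\ succP D S a (e 1)).
have Qd : fodef Q by rewrite /Q; fodef_auto.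
have [|s' [ok' E o' h]] := @add_explicit s Q (fun M => ev (bd M) Rsucc) ok Qd.
  move=> M S e i j Sa iM jM; rewrite /Q /=; split.
    case=> a [aM [/(agree_left ok Sa aM iM) Ea /(agree_succ ok Sa aM jM) ->]].
    by rewrite Ea.
  have aM := leq_trans (pleft_le i) iM.
  move=> Ej; exists (pleft i); split=> //.
  by split; [apply/(agree_left ok Sa)|apply/(agree_succ ok Sa)].
by exists s', (so s); split=> //; split=> // M i j _ _; rewrite h.
Qed.

Lemma compile_proj n (k : 'I_n) s : sys_ok s ->
  exists s' r, [/\ sys_ok s', ext s s' & realizes s' r (Rproj k)].
Proof.
move=> ok; pose Q : npred := fun A D S e => entryP D S k (e 0) (e 1).
have Qd : fodef Q by rewrite /Q; fodef_auto.
have [|s' [ok' E o' h]] := @add_explicit s Q (fun M => ev (bd M) (Rproj k)) ok Qd.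
  by move=> M S e i j Sa iM jM; rewrite /Q /= (agree_entry ok Sa).
by exists s', (so s); split=> //; split=> // M i j _ _; rewrite h.
Qed.

Lemma compile_comp k n (g : recf k) (h : 'I_k -> recf n) s rg rh :
  sys_ok s -> realizes s rg g -> (forall i, realizes s (rh i) (h i)) ->
  exists s' r, [/\ sys_ok s', ext s s' & realizes s' r (Rcomp g h)].
Proof.
move=> ok Rg Rh.
pose args A (D : A -> Prop) (S : nat -> A -> A -> Prop) w t (i : 'I_k) :=
  exists z, D z /\ (entryP D S i w z /\ S (rh i) t z).
pose Q : npred := fun A D S e => exists w, D w /\
  ((Gd D S w /\ S rg w (e 1)) /\ (forall i, args A D S w (e 0) i)).
have Qd : fodef Q.
  rewrite /Q; apply: fodef_ex; apply: fodef_and; first by repeat gd_step.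
  case: (posnP k) => [k0|k_gt0]; last first.
    by apply: fodef_forall_ord => // i; rewrite /args; repeat gd_step.
  (* Without arguments the conjunction is empty and is replaced by a tautology. *)
  apply: fodef_iff (fodef_eq 0 0) => A D S e; split=> // _ [i ik].
  by exfalso; rewrite k0 in ik.
have [|s' [ok' E o' H]] := @add_explicit s Q (fun M => ev (bd M) (Rcomp g h)) ok Qd.
  move=> M S e i j Sa iM jM; rewrite /Q /=; split.
    case=> w [wM [[/(Gd_nat (agree_ordered ok Sa) wM) wb Sg] Sh]].
    exists w; split=> // [l|]; last exact/(realizes_agree Rg Sa wM jM).
    have [z [zM [/(agree_entry ok Sa _ wM zM) <-]]] := Sh l.
    by move/(realizes_agree (Rh l) Sa iM zM).
  case=> w [wb Eh Eg]; have wM := below wb; exists w; split=> //; split.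
    split; first exact/(Gd_nat (agree_ordered ok Sa) wM).
    exact/(realizes_agree Rg Sa wM jM).
  move=> l; have lM := entry_le l wM; exists (entry l w); split=> //; split.
    exact/(agree_entry ok Sa).
  exact/(realizes_agree (Rh l) Sa iM lM).
by exists s', (so s); split=> //; split=> // M i j _ _; rewrite H.
Qed.

Lemma compile_mu n (g : recf n.+1) s rg :
  sys_ok s -> realizes s rg g ->
  exists s' r, [/\ sys_ok s', ext s s' & realizes s' r (Rmu g)].
Proof.
move=> ok Rg.
(* A nonzero value is an element [k] with a predecessor [k0]; the guard on [k] renders the bound on
   [k.+1] in [ev]. *)
pose Q : npred := fun A D S e =>
  (exists q, D q /\ (Gd D S q /\ (S 1 (e 1) q /\ (S 2 (e 0) q /\
     exists z, D z /\ (zeroP D S z /\ S rg q z))))) /\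
  (forall z, D z -> S 0 z (e 1) ->
     exists q, D q /\ (Gd D S q /\ (S 1 z q /\ (S 2 (e 0) q /\
     exists k, D k /\ (Gd D S k /\
       ((exists k0, D k0 /\ succP D S k0 k) /\ S rg q k)))))).
have Qd : fodef Q by rewrite /Q; repeat gd_step.
have [|s' [ok' E o' H]] := @add_explicit s Q (fun M => ev (bd M) (Rmu g)) ok Qd.
  move=> M S e i j Sa iM jM; rewrite /Q /=.
  have S0 := agree_ordered ok Sa; split.
    case=> [[q [qM [/(Gd_nat S0 qM) qb]]]].
    case=> [/(agree_left ok Sa jM qM) El [/(agree_right ok Sa iM qM) Er]].
    case=> z [zM [/(agree_zero ok Sa zM) -> /(realizes_agree Rg Sa qM (leq0n _)) E0]].
    move=> Hz; split; first by exists q.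
    move=> x xj; have xM := leq_trans (ltnW xj) jM.
    have [q' [qM' [/(Gd_nat S0 qM') qb']]] := Hz x xM (proj2 (S0 _ _ xM jM) xj).
    case=> [/(agree_left ok Sa xM qM') El' [/(agree_right ok Sa iM qM') Er']].
    case=> k [kM [/(Gd_nat S0 kM) kb [[k0 [kM0 /(agree_succ ok Sa kM0 kM) Ek]]]]].
    move/(realizes_agree Rg Sa qM' kM) => Eg.
    by exists q', k0; rewrite -Ek.
  case=> [[q [qb El Er E0]] Hz]; have qM := below qb; split.
    exists q; split=> //; split; first exact/(Gd_nat S0).
    split; first exact/(agree_left ok Sa).
    split; first exact/(agree_right ok Sa).
    exists 0; split=> //; split; first exact/(agree_zero ok Sa).
    exact/(realizes_agree Rg Sa).
  move=> x xM /(S0 _ _ xM jM) /Hz [q' [k [qb' kb El' Er' Eg]]].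
  have qM' := below qb'; have kM := below kb.
  exists q'; split=> //; split; first exact/(Gd_nat S0).
  split; first exact/(agree_left ok Sa).
  split; first exact/(agree_right ok Sa).
  exists k.+1; split=> //; split; first exact/(Gd_nat S0).
  split; last exact/(realizes_agree Rg Sa).
  by exists k; split; [exact: ltnW|apply/(agree_succ ok Sa) => //; exact: ltnW].
by exists s', (so s); split=> //; split=> // M i j _ _; rewrite H.
Qed.

(** The defining formula refers to the new symbol [o], but only at codes whose left component is one
    smaller; induction on the left component therefore makes the solution unique. *)
Lemma compile_prec n (g : recf n) (h : recf n.+2) s rg rh :
  sys_ok s -> realizes s rg g -> realizes s rh h ->
  exists s' r, [/\ sys_ok s', ext s s' & realizes s' r (Rprec g h)].
Proof.
move=> ok Rg Rh; pose o := so s.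
pose step A (D : A -> Prop) (S : nat -> A -> A -> Prop) a u y := 
  exists t', D t' /\ (Gd D S t' /\ (S 2 u t' /\
  exists a', D a' /\ (S 1 a' t' /\ (succP D S a' a /\
  exists z, D z /\ (Gd D S z /\ (S o t' z /\
  exists q, D q /\ (Gd D S q /\ (S 1 a' q /\ (S rh q y /\
  exists v, D v /\ (S 2 v q /\ (S 1 z v /\ S 2 u v))))))))))).
pose Q : npred := fun A D S e =>
  exists a, D a /\ (S 1 a (e 0) /\ exists u, D u /\ (S 2 u (e 0) /\
  ((zeroP D S a /\ S rg u (e 1)) \/ step A D S a u (e 1)))).
have Qd : fodef Q by rewrite /Q /step; repeat gd_step.
pose new M := ev (bd M) (Rprec g h).
have [|s' [ok' E o' H]] := @add_relation s Q new ok Qd; last first.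
  by exists s', (so s); split=> //; split=> // M i j _ _; rewrite H.
move=> M S e Sa; have S0 := agree_ordered ok Sa.
(* one unfolding of the recursion, for a relation that is correct below [i] *)
have unfold i j : i <= M -> j <= M ->
    (forall t z, t <= M -> z <= M -> pleft t < pleft i -> (S o t z <-> new M t z)) ->
    (Q nat (upto M) S (scons i (scons j e)) <-> new M i j).
  move=> iM jM IH; rewrite /Q /=.
  have lM := leq_trans (pleft_le i) iM; have rM := leq_trans (pright_le i) iM.
  split.
    case=> a [aM [/(agree_left ok Sa aM iM) Ea [u [uM [/(agree_right ok Sa uM iM) Eu]]]]].
    case=> [[/(agree_zero ok Sa aM) a0 /(realizes_agree Rg Sa uM jM) Eg]|].
      by rewrite /new /= -Ea a0 /= -Ea -Eu.
    case=> t' [tM [/(Gd_nat S0 tM) tb [/(agree_right ok Sa uM tM) Et]]].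
    case=> a' [aM' [/(agree_left ok Sa aM' tM) Ea' [/(agree_succ ok Sa aM' aM) aa']]].
    case=> z [zM [/(Gd_nat S0 zM) zb [Ez]]].
    case=> q [qM [/(Gd_nat S0 qM) qb [/(agree_left ok Sa aM' qM) lq]]].
    case=> [/(realizes_agree Rh Sa qM jM) Eh [v [vM []]]].
    move=> /(agree_right ok Sa vM qM) Ev [/(agree_left ok Sa zM vM) lv].
    move=> /(agree_right ok Sa uM vM) rv.
    have {Ez} Ez : new M t' z by apply/IH => //; rewrite -Ea -Ea' aa'.
    rewrite /new /= -Ea aa' /=; split; first by rewrite -Ea.
    exists t', z, q; split=> //; split.
      by split=> //; [rewrite -Et -Eu|move: Ez; rewrite /new /= -Ea'].
    by split=> //; rewrite -Ev -?rv -?lv -?Eu.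
  move=> Ei; exists (pleft i); split=> //; split; first exact/(agree_left ok Sa).
  exists (pright i); split=> //; split; first exact/(agree_right ok Sa).
  move: Ei; rewrite /new /=; move def_k: (pleft i) => [|k] /=.
    case=> _ Eg; left; split; first exact/(agree_zero ok Sa).
    exact/(realizes_agree Rg Sa).
  case=> _ [t' [z [q [[tb zb qb] [[rt Et Eh] [lq lrq rrq]]]]]]; right.
  have tM := below tb; have zM := below zb; have qM := below qb.
  (* Both clauses of [prec_ev] record the left component of the code. *)
  have lt : pleft t' = k by case: (k) Et => [|k'] /= [].
  have kM : k <= M by rewrite -lt; apply: leq_trans (pleft_le _) tM.
  have vM := leq_trans (pright_le q) qM.
  exists t'; split=> //; split; first exact/(Gd_nat S0).
  split; first exact/(agree_right ok Sa).
  exists k; split=> //; split; first exact/(agree_left ok Sa).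
  split; first by apply/(agree_succ ok Sa) => //; rewrite -def_k.
  exists z; split=> //; split; first exact/(Gd_nat S0).
  split; first by apply/IH => //; rewrite ?def_k ?lt // /new /= lt.
  exists q; split=> //; split; first exact/(Gd_nat S0).
  split; first exact/(agree_left ok Sa).
  split; first exact/(realizes_agree Rh Sa).
  exists (pright q); split=> //; split; first exact/(agree_right ok Sa).
  by split; [apply/(agree_left ok Sa)|apply/(agree_right ok Sa)].
split=> Hall.
  move=> i; move def_k: (pleft i) => k; move: i def_k.
  elim/ltn_ind: k => k IHk i ik j iM jM; rewrite Hall // unfold //.
  by move=> t z tM zM lt; apply: (IHk (pleft t)) => //; rewrite -ik.
by move=> i j iM jM; rewrite Hall // unfold // => t z tM zM _; apply: Hall.
Qed.

Theorem compile n (c : recf n) s : sys_ok s ->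
  exists s' r, [/\ sys_ok s', ext s s' & realizes s' r c].
Proof.
elim: c s => {n} [n||n i|k n g IHg h IHh|n g IHg h IHh|n g IHg] s ok.
- exact: compile_zero.
- exact: compile_succ.
- exact: compile_proj.
- have [s1 [rg [ok1 E1 R1]]] := IHg s ok.
  (* The argument codes are compiled one after another into a growing system; relations obtained
     earlier survive by [realizes_ext]. *)
  have H m : m <= k -> exists s2 (rh : 'I_k -> nat), [/\ sys_ok s2, ext s1 s2 &
      forall i : 'I_k, i < m -> realizes s2 (rh i) (h i)].
    elim: m => [_|m IHm mk]; first by exists s1, (fun=> 0).
    have [s2 [rh [ok2 E2 R2]]] := IHm (ltnW mk).
    have [s3 [r [ok3 E3 R3]]] := IHh (Ordinal mk) s2 ok2.
    exists s3, (fun i => if i == Ordinal mk then r else rh i); split=> //.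
      exact: ext_trans E3.
    move=> i; rewrite ltnS leq_eqVlt; case: (eqVneq i (Ordinal mk)) => [->|ni] //.
    case/orP=> [/eqP im|im]; first by case/eqP: ni; apply: val_inj.
    exact: realizes_ext (R2 i im).
  have [s2 [rh [ok2 E2 R2]]] := H k (leqnn _).
  have [s3 [r [ok3 E3 R3]]] := compile_comp ok2 (realizes_ext E2 R1)
    (fun i => R2 i (ltn_ord i)).
  exists s3, r; split=> //; exact: ext_trans E1 (ext_trans E2 E3).
- have [s1 [rg [ok1 E1 R1]]] := IHg s ok.
  have [s2 [rh [ok2 E2 R2]]] := IHh s1 ok1.
  have [s3 [r [ok3 E3 R3]]] := compile_prec ok2 (realizes_ext E2 R1) R2.
  exists s3, r; split=> //; exact: ext_trans E1 (ext_trans E2 E3).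
- have [s1 [rg [ok1 E1 R1]]] := IHg s ok.
  have [s2 [r [ok2 E2 R2]]] := compile_mu ok1 R1.
  exists s2, r; split=> //; exact: ext_trans E1 E2.
Qed.

End Compile.

(** * The least bound within which the function converges on [0, ..., N] *)

Section LeastBound.
Variables (c : recf 1) (f : nat -> nat).
Hypothesis c_f : forall x, computes c [tuple x] (f x).

(** Only [pleft t] is prescribed: a code of a vector of length one may have any tail. *)
Definition converges N b := forall j, j <= N ->
  exists t, t < b /\ pleft t = j /\ exists y, y < b /\ ev b c t y.

Lemma converges_mono N b b' : b <= b' -> converges N b -> converges N b'.
Proof.
move=> bb h j /h[t [tb [lt [y [yb E]]]]]; exists t.
split; [exact: leq_trans bb|split=> //; exists y].
by split; [exact: leq_trans bb|exact: ev_mono E].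
Qed.

Lemma converges_ex N : exists b, converges N b.
Proof.
have [||b hb] := @uniform_bound (fun j b =>
  exists t, t < b /\ pleft t = j /\ exists y, y < b /\ ev b c t y) N.+1.
- move=> i b b' bb [t [tb [lt [y [yb E]]]]]; exists t.
  split; [exact: leq_trans bb|split=> //; exists y].
  by split; [exact: leq_trans bb|exact: ev_mono E].
- move=> j _; have [t ht] := vec_surj [tuple j].
  have [|b hb] := @ev_complete _ c t (f j); first by rewrite ht.
  exists (maxn b (maxn t.+1 (f j).+1)), t; split; first lia.
  split; last by exists (f j); split; [lia|apply: ev_mono hb; lia].
  by have := congr1 (fun v => tnth v ord0) ht; rewrite tnth_mktuple.
by exists b => j jN; apply: hb.
Qed.

Lemma converges_bound N b j : converges N b -> j <= N -> f j < b.
Proof.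
move=> h /h[t [_ [lt [y [yb /ev_sound]]]]].
have -> : vec 1 t = [tuple j].
  apply: eq_from_tnth => i; rewrite tnth_mktuple (ord1 i) tnth0.
  by rewrite -lt.
by move/(computes_functional (c_f j)) ->.
Qed.

Lemma converges_lt N b : converges N b -> N < b.
Proof. by move/(_ N (leqnn _)) => [t [tb [<- _]]]; have := pleft_le t; lia. Qed.

(** Convergence is monotone in the bound and fails at 0, so it has a threshold, and [M0] is the
    predecessor of the least good bound. Comparing [M + 1] with [M] can be expressed inside
    [[0 .. M]]. *)
Lemma least_bound_ex N :
  exists M0, forall M, converges N M.+1 /\ ~ converges N M <-> M = M0.
Proof.
have [b /asboolP hb] := converges_ex N.
case: (ex_minnP (ex_intro (fun b => `[< converges N b >]) b hb)).
case=> [/asboolP/converges_lt//|M0 /asboolP h hmin].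
exists M0 => M; split=> [[h1 h2]|->].
  apply/eqP; rewrite eqn_leq -[M0 <= M]ltnS hmin; last exact/asboolP.
  rewrite andbT leqNgt; apply/negP => lt; apply: h2; exact: converges_mono h.
by split=> // /asboolP/hmin; rewrite ltnn.
Qed.

End LeastBound.

(** * Naming [2a] and expressing the least bound by formulas *)

Fixpoint numP a A (D : A -> Prop) (S : nat -> A -> A -> Prop) x : Prop :=
  if a is a'.+1 then
    exists y, D y /\ (numP a' D S y /\
      exists z, D z /\ (succP D S y z /\ succP D S z x))
  else zeroP D S x.

(* One quantifier per two steps: this is what makes the depth of the final
   sentence drop below the number it names. *)
Lemma ndef_num : exists C, forall a i, ndef (a + C) (fun A D S e => numP a D S (e i)).
Proof.
have [C0 h0] := fodef_zero 0.
have [C1 h1] : fodef (fun A D S e => exists z, D z /\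
  (succP D S (e 0) z /\ succP D S z (e 1))) by fodef_auto.
exists (maxn C0 C1) => a; elim: a => [|a IH] i /=.
  by have := ndef_rename (fun=> i) h0; apply: ndef_leq; rewrite add0n leq_maxl.
rewrite addSn; apply: ndef_ex; apply: ndef_and; first exact: IH.
(* Under the new quantifier [y] is index 0 and [x] has moved to [i.+1]. *)
have := ndef_rename (fun k => if k is 0 then 0 else i.+1) h1.
by apply: ndef_leq; lia.
Qed.

Lemma numP_nat a M S x : ordered M S -> x <= M ->
  (numP a (upto M) S x <-> x = a.*2).
Proof.
move=> S0; elim: a x => [|a IH] x xM /=; first exact: zeroP_nat.
split=> [[y [yM [/(IH _ yM) Ey [z [zM []]]]]]|Ex].
  by move=> /(succP_nat S0 yM zM) Ez /(succP_nat S0 zM xM) ->; rewrite Ez Ey doubleS.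
have yM : a.*2 <= M by lia.
have zM : a.*2.+1 <= M by lia.
exists a.*2; split=> //; split; first exact/IH.
exists a.*2.+1; split=> //; split; first exact/succP_nat.
by apply/succP_nat => //; rewrite Ex doubleS.
Qed.

Definition goodP (Gd : epred) r A (D : A -> Prop) (S : nat -> A -> A -> Prop) x :=
  forall j, D j -> (S 0 j x \/ j = x) -> exists t, D t /\ (Gd A D S t /\ (S 1 j t /\
    exists y, D y /\ (Gd A D S y /\ S r t y))).

Lemma goodP_nat (Gd : epred) bd s r (c : recf 1) M S x :
  (forall M S x, ordered M S -> x <= M -> (Gd nat (upto M) S x <-> x < bd M)) ->
  (forall M, bd M <= M.+1) -> sys_ok s -> realizes bd s r c ->
  agree (so s) M S (sstd s M) -> x <= M ->
  (goodP Gd r (upto M) S x <-> converges c x (bd M)).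
Proof.
move=> Gn bdM ok R Sa xM; have S0 := agree_ordered ok Sa; split=> h j.
  move=> jx; have jM := leq_trans jx xM.
  have [|t [tM [/(Gn _ _ _ S0 tM) tb [/(agree_left ok Sa jM tM) lt]]]] := h j jM.
    by rewrite S0 //; move: jx; rewrite leq_eqVlt => /orP[/eqP|]; auto.
  case=> y [yM [/(Gn _ _ _ S0 yM) yb /(realizes_agree R Sa tM yM) E]].
  by exists t; split=> //; split=> //; exists y.
move=> jM jx; have [|t [tb [lt [y [yb E]]]]] := h j.
  by case: jx => [|->] //; rewrite S0 // => /ltnW.
have tM : t <= M by have := bdM M; lia.
have yM : y <= M by have := bdM M; lia.
exists t; split=> //; split; first exact/Gn.
split; first exact/(agree_left ok Sa).
by exists y; split=> //; split; [exact/Gn|exact/(realizes_agree R Sa)].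
Qed.

(** The system and [C] depend on the code of [f] only and are fixed before [a]. [Th] says that
    evaluation converges up to [2a] within the bound [M + 1] but not within [M]. *)
Theorem axiomatic_bound (f : nat -> nat) : total_recursive f ->
  exists s C, sys_ok s /\ forall a, exists Th M0, [/\ ndef (a + C) Th,
    forall M S e, agree (so s) M S (sstd s M) -> (Th nat (upto M) S e <-> M = M0) &
    forall j, j <= a.*2 -> f j <= M0].
Proof.
case=> c c_f.
(* On [[0 .. M]] the guard [G1] always holds, which is the bound [M + 1]; [G0] excludes the last
   element, which is the bound [M]. *)
pose G1 : epred := fun A D S x => x = x.
pose G0 : epred := fun A D S x => exists z, D z /\ S 0 x z.
have G1d i : fodef (fun A D S e => G1 A D S (e i)) by rewrite /G1; fodef_auto.
have G0d i : fodef (fun A D S e => G0 A D S (e i)) by rewrite /G0; fodef_auto.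
have G1n M S x : ordered M S -> x <= M -> (G1 nat (upto M) S x <-> x < M.+1).
  by rewrite ltnS /G1.
have G0n M S x : ordered M S -> x <= M -> (G0 nat (upto M) S x <-> x < M).
  move=> S0 xM; split=> [[z [zM /(S0 _ _ xM zM) xz]]|xM'].
    by rewrite /upto in zM; lia.
  by exists M; split; [exact: leqnn|apply/S0].
have [s1 [r1 [ok1 E1 R1]]] :=
  compile (bd := fun M => M.+1) G1d (fun M => leqnn _) G1n c base_sys_ok.
have [s [r0 [ok E0 R0]]] := compile (bd := id) G0d (fun M => leqnSn _) G0n c ok1.
have {ok1 E1 E0} R1 := realizes_ext E0 R1.
have [C2 hC2] := ndef_num.
have [C1 hC1] : fodef (fun A D S e => goodP G1 r1 D S (e 0) /\
    ~ goodP G0 r0 D S (e 0)).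
  by rewrite /goodP; repeat first [apply G1d | apply G0d | fodef_step].
exists s, (maxn C1 C2).+1; split=> // a.
have [M0 hM0] := least_bound_ex c_f a.*2.
exists (fun A D S e => exists x, D x /\ (numP a D S x /\
  (goodP G1 r1 D S x /\ ~ goodP G0 r0 D S x))), M0; split.
- rewrite addnS; apply: ndef_ex; apply: ndef_and.
    by apply: ndef_leq (hC2 a 0); lia.
  by apply: ndef_leq hC1; lia.
- move=> M S e Sa; have S0 := agree_ordered ok Sa; rewrite -hM0; split.
    case=> x [xM [/(numP_nat _ S0 xM) Ex]].
    by rewrite (goodP_nat G1n _ ok R1 Sa) // (goodP_nat G0n _ ok R0 Sa) // Ex.
  move=> h; have aM : a.*2 <= M by case: h => /converges_lt.
  exists a.*2; split=> //; split; first exact/numP_nat.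
  by rewrite (goodP_nat G1n _ ok R1 Sa) // (goodP_nat G0n _ ok R0 Sa).
- move=> j ja; have [h _] := proj2 (hM0 M0) erefl.
  by have := converges_bound c_f h ja.
Qed.

(** * Definability over graphs with a vertex set and marked vertices *)

Section GraphDefinability.
Variable t : nat.

Definition gpred := forall G : sgraph, {set G} -> (nat -> G) -> (nat -> G) -> Prop.

Definition mark (G : sgraph) (m : t.+1.-tuple G) (i : nat) : G := tnth m (inord i).

(* The markers form the end of the environment; the last one also serves as
   the value of the variables that are out of scope. *)
Definition gdef d (P : gpred) := forall n,
  exists2 p : fo 1 (n + t.+1), qdepth p <= d &
    forall (G : sgraph) (X : 1.-tuple {set G}) (m : t.+1.-tuple G) (s : n.-tuple G),
      sat X p [tuple of s ++ m] <->
      P G (tnth X ord0) (mark m) (nth (mark m t) s).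

Definition gterm (x : forall G : sgraph, (nat -> G) -> (nat -> G) -> G) :=
  forall n, exists k : 'I_(n + t.+1),
    forall (G : sgraph) (m : t.+1.-tuple G) (s : n.-tuple G),
      tnth [tuple of s ++ m] k = x G (mark m) (nth (mark m t) s).

Lemma gterm_mark i : gterm (fun G m e => m i).
Proof. by move=> n; exists (rshift n (inord i)) => G m s; rewrite tnth_rshift. Qed.

Lemma gterm_var i : gterm (fun G m e => e i).
Proof.
move=> n; have [i_n|n_i] := ltnP i n.
  exists (lshift _ (Ordinal i_n)) => G m s.
  by rewrite tnth_lshift (tnth_nth (mark m t)).
exists (rshift n (inord t)) => G m s.
by rewrite tnth_rshift nth_default // size_tuple.
Qed.

Lemma gdef_adj x y : gterm x -> gterm y ->
  gdef 0 (fun G X m e => adj (x G m e) (y G m e)).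
Proof.
move=> hx hy n; have [i hi] := hx n; have [j hj] := hy n.
by exists (Adj i j) => // G X m s; rewrite /= hi hj.
Qed.

Lemma gdef_eq x y : gterm x -> gterm y ->
  gdef 0 (fun G X m e => x G m e = y G m e).
Proof.
move=> hx hy n; have [i hi] := hx n; have [j hj] := hy n.
by exists (Eq i j) => // G X m s; rewrite /= hi hj; split=> /eqP.
Qed.

Lemma gdef_mem x : gterm x -> gdef 0 (fun G X m e => x G m e \in X).
Proof.
move=> hx n; have [i hi] := hx n.
by exists (Defs.Mem i ord0) => // G X m s; rewrite /= hi.
Qed.

Lemma gdef_leq d d' P : d <= d' -> gdef d P -> gdef d' P.
Proof. by move=> dd h n; have [p pd hp] := h n; exists p => //; apply: leq_trans dd. Qed.

Lemma gdef_iff d (P Q : gpred) :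
  (forall G X m e, P G X m e <-> Q G X m e) -> gdef d P -> gdef d Q.
Proof.
by move=> PQ h n; have [p pd hp] := h n; exists p => // G X m s; rewrite hp.
Qed.

Lemma gdef_not d (P : gpred) : gdef d P -> gdef d (fun G X m e => ~ P G X m e).
Proof.
move=> h n; have [p pd hp] := h n; exists (Neg p) => // G X m s /=.
by rewrite -hp; split=> /negP.
Qed.

Lemma gdef_and d (P Q : gpred) : gdef d P -> gdef d Q ->
  gdef d (fun G X m e => P G X m e /\ Q G X m e).
Proof.
move=> hP hQ n; have [p pd hp] := hP n; have [q qd hq] := hQ n.
exists (And p q) => [|G X m s] /=; first by rewrite geq_max pd.
by rewrite -hp -hq; split=> /andP.
Qed.

Lemma gdef_ex d (P : forall G : sgraph, {set G} -> (nat -> G) -> (nat -> G) -> G -> Prop) :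
  gdef d (fun G X m e => P G X m (stail e) (e 0)) ->
  gdef d.+1 (fun G X m e => exists x, P G X m e x).
Proof.
move=> h n; have [p pd hp] := h n.+1; exists (Ex p : fo 1 (n + t.+1)) => // G X m s.
have E x : [tuple of x :: [tuple of s ++ m]] = [tuple of [tuple of x :: s] ++ m].
  exact: val_inj.
split=> [/existsP[x]|[x hx]]; first by rewrite E => /hp; exists x.
by apply/existsP; exists x; rewrite E; apply/hp.
Qed.

(** A first-order interpretation: replacing the domain and the relation symbols by graph formulas of
    depth at most [k] adds only [k] to the depth. *)
Lemma gdef_nsem (D : forall G : sgraph, {set G} -> (nat -> G) -> G -> Prop)
    (S : forall G : sgraph, {set G} -> (nat -> G) -> nat -> G -> G -> Prop) k d P :
  (forall i, gdef k (fun G X m e => D G X m (e i))) ->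
  (forall r i j, gdef k (fun G X m e => S G X m r (e i) (e j))) ->
  ndef d P -> gdef (d + k) (fun G X m e => P G (D G X m) (S G X m) e).
Proof.
move=> hD hS [p pd hp].
suff : gdef (ndepth p + k) (fun G X m e => nsem (D G X m) (S G X m) p e).
  move=> h; apply: (@gdef_leq (ndepth p + k)); first by rewrite leq_add2r.
  by apply: gdef_iff h => G X m e; apply: hp.
elim: p {pd hp} => [r i j|i j|p IH|p IHp q IHq|p IH] /=.
- exact: hS.
- by apply: (@gdef_leq 0) => //; apply: gdef_eq; apply: gterm_var.
- exact: gdef_not.
- by apply: gdef_and; [apply: gdef_leq IHp|apply: gdef_leq IHq]; lia.
- rewrite addSn; apply: gdef_ex; apply: gdef_and; first by apply: gdef_leq (hD 0); lia.
  apply: gdef_iff IH => G X m e.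
  by have -> : e = scons (e 0) (stail e) by apply/funext => -[].
Qed.

(** Depth 1 comes from the truth constant [fo_top] that ends the conjunction; the literals are
    quantifier-free. *)
Lemma gdef_nonadjacent : gdef 1
  (fun G X m e => forall i j, i < t -> j < t -> ~ adj (m i) (m j)).
Proof.
move=> n; pose lit (q : 'I_t.+1 * 'I_t.+1) : fo 1 (n + t.+1) :=
  Neg (Adj (rshift n q.1) (rshift n q.2)).
pose qs := [seq q : 'I_t.+1 * 'I_t.+1 <- enum {: 'I_t.+1 * 'I_t.+1} | (q.1 < t) && (q.2 < t)].
exists (fo_conj [seq lit q | q <- qs]).
  by elim: qs => //= q qs IH; rewrite geq_max.
move=> G X m s; rewrite sat_conj all_map; split=> [/allP h i j it jt|h].
  have := h (inord i, inord j); rewrite mem_filter mem_enum /=.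
  by rewrite (inordK (leqW it)) (inordK (leqW jt)) it jt !tnth_rshift => /(_ isT)/negP.
apply/allP => -[i j]; rewrite mem_filter => /andP[/andP[/= it jt] _].
rewrite /= !tnth_rshift; apply/negP; have := h i j it jt.
by rewrite /mark !inord_val.
Qed.

End GraphDefinability.

(** * Enumerating a finite linear order *)

Definition linear A (D : A -> Prop) (S : nat -> A -> A -> Prop) :=
  (forall x, D x -> ~ S 0 x x) /\
  (forall x, D x -> forall y, D y -> forall z, D z -> S 0 x y -> S 0 y z -> S 0 x z) /\
  (forall x, D x -> forall y, D y -> S 0 x y \/ x = y \/ S 0 y x).

Lemma fodef_linear : fodef (fun A D S _ => linear D S).
Proof. by rewrite /linear; fodef_auto. Qed.

(** The rank of an element, its number of predecessors in [D], is strictly increasing, hence a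
    bijection from [D] onto [[0 .. M]] with [M + 1 = #|D|]. *)
Lemma linear_enum (T : finType) (D : {set T}) (S : nat -> T -> T -> Prop) x0 :
  x0 \in D -> linear (fun x => x \in D) S ->
  exists M (f : nat -> T), [/\ forall i, i <= M -> f i \in D,
    forall y, y \in D -> exists2 i, i <= M & f i = y &
    forall i j, i <= M -> j <= M -> (S 0 (f i) (f j) <-> i < j)].
Proof.
move=> Dx0 [irr [tr tot]].
pose B x := [set y in D | `[< S 0 y x >]].
pose rk x := #|B x|.
have rk_mono x y : x \in D -> y \in D -> S 0 x y -> rk x < rk y.
  move=> Dx Dy xy; apply: proper_card; apply/properP; split.
    apply/subsetP => z; rewrite !inE => /andP[Dz /asboolP zx].
    by rewrite Dz; apply/asboolP; apply: tr zx xy.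
  exists x; rewrite !inE Dx; first exact/asboolP.
  by apply/negP => /asboolP; apply: irr.
have rkP x y : x \in D -> y \in D -> (S 0 x y <-> rk x < rk y).
  move=> Dx Dy; split; first exact: rk_mono.
  have [//|[->|yx]] := tot x Dx y Dy; first by rewrite ltnn.
  by have := rk_mono _ _ Dy Dx yx; lia.
have rk_inj x y : x \in D -> y \in D -> rk x = rk y -> x = y.
  move=> Dx Dy E; have [xy|[//|yx]] := tot x Dx y Dy.
    by have := rk_mono _ _ Dx Dy xy; rewrite E ltnn.
  by have := rk_mono _ _ Dy Dx yx; rewrite E ltnn.
have rk_lt x : x \in D -> rk x < #|D|.
  move=> Dx; apply: proper_card; apply/properP; split.
    by apply/subsetP => z; rewrite inE => /andP[].
  by exists x => //; rewrite inE Dx /=; apply/negP => /asboolP; apply: irr.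
have D_gt0 : 0 < #|D| by apply/card_gt0P; exists x0.
have rk_surj i : i < #|D| -> exists2 x, x \in D & rk x = i.
  move=> iD; pose r (x : T) : 'I_#|D| := insubd (Ordinal D_gt0) (rk x).
  have rE x : x \in D -> r x = rk x :> nat.
    by move=> Dx; rewrite val_insubd rk_lt.
  have r_inj : {in D &, injective r}.
    by move=> x y Dx Dy /(congr1 val) /=; rewrite !rE //; apply: rk_inj.
  have : Ordinal iD \in r @: D.
    suff -> : r @: D = setT by rewrite inE.
    by apply/eqP; rewrite eqEcard subsetT cardsT card_ord card_in_imset /=.
  by case/imsetP=> x Dx /(congr1 val) /= E; exists x; rewrite -?rE.
have /choice[f hf] : forall i, exists x, i < #|D| -> x \in D /\ rk x = i.
  move=> i; have [/rk_surj[x Dx rx]|_] := ltnP i #|D|; first by exists x.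
  by exists x0.
have hM i : i <= #|D|.-1 -> i < #|D| by lia.
exists #|D|.-1, f; split.
- by move=> i /hM/hf[].
- move=> y Dy; have := rk_lt y Dy => lt; exists (rk y); first lia.
  by have [Df rf] := hf _ lt; apply: rk_inj.
- move=> i j /hM/hf[Di ri] /hM/hf[Dj rj].
  by rewrite rkP // ri rj.
Qed.

(** * Coding a family of binary relations by a graph *)

Section CodeGraph.
Variables (k M : nat) (S : nat -> nat -> nat -> Prop).

(* Sort 0 is a clique carrying the domain, each other sort is a copy of the
   domain matched with sort 0, and relation [r] is drawn between the copies
   [r + 2] and [1]. *)
Definition cell_adj (a b i j : nat) : bool :=
  if a == 0 then (if b == 0 then i != j else i == j)
  else if b == 0 then i == j
  else if (a == 1) && (1 < b) then `[< S b.-2 j i >]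
  else if (b == 1) && (1 < a) then `[< S a.-2 i j >]
  else false.

(** The vertex [inl a] is a marker for sort [a]: it sees exactly the cells of that sort and no other
    marker. *)
Definition code_adj : rel ('I_k.+2 + 'I_k.+2 * 'I_M.+1) := fun u v =>
  match u, v with
  | inl _, inl _ => false
  | inl a, inr (b, _) | inr (b, _), inl a => a == b
  | inr (a, i), inr (b, j) => cell_adj a b i j
  end.

Lemma cell_adj_sym a b i j : cell_adj a b i j = cell_adj b a j i.
Proof.
rewrite /cell_adj; case: a b => [|[|a]] [|[|b]] //=; rewrite ?[j == i]eq_sym //.
Qed.

Lemma code_sym : symmetric code_adj.
Proof. by case=> [a|[a i]] [b|[b j]] //=; apply: cell_adj_sym. Qed.

Lemma code_irrefl : irreflexive code_adj.
Proof.
case=> [a|[a i]] //=; rewrite /cell_adj; case: a => -[|[|a]] ak //=.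
by rewrite eqxx.
Qed.

Definition code_graph : sgraph := SGraph code_sym code_irrefl.

End CodeGraph.

(** The pairs of sorts between which edges may occur: sort 0 with any sort, and sort 1 with the
    sorts from 2 on. *)
Definition linked (a b : nat) : bool :=
  [|| a == 0, b == 0 | (a == 1) != (b == 1)].

(* In this vocabulary symbol 0 is adjacency and symbol [a.+1] is the (unary)
   predicate of membership in sort [a]. *)
Definition layout k A (D : A -> Prop) (S : nat -> A -> A -> Prop) :=
  (forall a b : 'I_k.+2, forall x, D x -> S a.+1 x x -> S b.+1 x x -> a = b) /\
  (forall a b : 'I_k.+2, forall u, D u -> S a.+1 u u ->
     forall v, D v -> S b.+1 v v -> S 0 u v -> linked a b) /\
  (forall x, D x -> S 1 x x -> forall y, D y -> S 1 y y -> x = y \/ S 0 x y) /\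
  (forall a : 'I_k.+2, 0 < a -> forall x, D x -> S 1 x x ->
     (exists u, D u /\ (S a.+1 u u /\ S 0 x u)) /\
     (forall u, D u -> S a.+1 u u -> S 0 x u ->
        (forall u', D u' -> S a.+1 u' u' -> S 0 x u' -> u = u') /\
        (forall x', D x' -> S 1 x' x' -> S 0 x' u -> x = x'))).

Lemma fodef_layout k : fodef (fun A D S _ => layout k D S).
Proof.
rewrite /layout; apply: fodef_and; last apply: fodef_and; last apply: fodef_and.
- do 2 (apply: fodef_forall_ord => // ?).
  by repeat first [apply fodef_const | fodef_step].
- do 2 (apply: fodef_forall_ord => // ?).
  by repeat first [apply fodef_const | fodef_step].
- by fodef_auto.
- apply: fodef_forall_ord => // a; apply: fodef_imp; first exact: fodef_const.
  by fodef_auto.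
Qed.

(** * Recognizing a copy of the code graph inside a marked graph *)

Section MarkedGraph.
Variables (G : sgraph) (X : {set G}) (m : nat -> G).

Definition sgrel (r : nat) (x y : G) : Prop :=
  if r is a.+1 then adj (m a) x else adj x y.

Definition dom : {set G} := [set x in X | adj (m 0) x].

(** Decodes relation [r] by a path: from [x] to its mate in sort [r + 2], across to sort 1, and back
    to [y]. Using separate copies lets a simple graph carry asymmetric and reflexive relations. *)
Definition srel (r : nat) (x y : G) : Prop :=
  exists u, exists v, (u \in X /\ adj (m r.+2) u) /\
    ((v \in X /\ adj (m 1) v) /\ (adj x u /\ (adj u v /\ adj v y))).

Section Embedding.
Variables (k M : nat) (S : nat -> nat -> nat -> Prop) (f : nat -> G).
Hypothesis m_nonadj : forall a b, a < k.+2 -> b < k.+2 -> ~ adj (m a) (m b).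
Hypothesis Xlay : layout k (fun x => x \in X) sgrel.
Hypothesis f_dom : forall i, i <= M -> f i \in dom.
Hypothesis f_inj : forall i j, i <= M -> j <= M -> f i = f j -> i = j.
Hypothesis f_rel : forall r i j, r < k -> i <= M -> j <= M ->
  (srel r (f i) (f j) <-> S r i j).

(** The markers and the mates of the [f i] span the copy: [layout] and [f_rel] determine every
    adjacency among them. The set [X] itself may be larger than the copy. *)
Lemma layout_embedding : contains_induced (code_graph k M S) G.
Proof.
have [uniq_sort [link [clique match_]]] := Xlay.
have fX i : i <= M -> f i \in X by move/f_dom; rewrite inE => /andP[].
have f0 i : i <= M -> adj (m 0) (f i) by move/f_dom; rewrite inE => /andP[].
(* [c (a, i)] is the mate of [f i] in sort [a], and [f i] itself in sort 0. *)
have /choice[c hc] (q : 'I_k.+2 * 'I_M.+1) : exists u : G,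
    [/\ u \in X, adj (m q.1) u &
        if 0 < q.1 then adj (f q.2) u : Prop else u = f q.2].
  case: q => a i; have iM : i <= M by rewrite -ltnS.
  case: (posnP a) => [a0|a_gt0] /=.
    by exists (f i); rewrite a0; split; [exact: fX|exact: f0|].
  have [[u [uX [ua iu]]] _] := match_ a a_gt0 (f i) (fX i iM) (f0 i iM).
  by exists u.
have cX q : c q \in X by have [] := hc q.
have ca (a : 'I_k.+2) (i : 'I_M.+1) : adj (m a) (c (a, i)) by have [] := hc (a, i).
have c0 (a : 'I_k.+2) (i : 'I_M.+1) : a = 0 :> nat -> c (a, i) = f i.
  by move=> a0; have [_ _] := hc (a, i); rewrite /= a0.
have cf (a : 'I_k.+2) (i : 'I_M.+1) : 0 < a -> adj (f i) (c (a, i)).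
  by move=> a0; have [_ _] := hc (a, i); rewrite /= a0.
have leM (i : 'I_M.+1) : i <= M by rewrite -ltnS.
have c_mate (a : 'I_k.+2) (i j : 'I_M.+1) : 0 < a -> adj (f j) (c (a, i)) -> i = j.
  move=> a0 ji; apply: val_inj; apply: (f_inj (leM i) (leM j)).
  have [_ /(_ _ (cX (a, i)) (ca a i) (cf a i a0))] :=
    match_ a a0 (f i) (fX i (leM i)) (f0 i (leM i)).
  by case=> _ /(_ _ (fX j (leM j)) (f0 j (leM j)) ji).
have c_uniq (a : 'I_k.+2) (i : 'I_M.+1) u :
    0 < a -> u \in X -> adj (m a) u -> adj (f i) u -> c (a, i) = u.
  move=> a0 uX au iu.
  have [_ /(_ _ (cX (a, i)) (ca a i) (cf a i a0))] :=
    match_ a a0 (f i) (fX i (leM i)) (f0 i (leM i)).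
  by case=> /(_ u uX au iu).
have c_rel (a b : 'I_k.+2) (i j : 'I_M.+1) : a = 1 :> nat -> 1 < b ->
    adj (c (a, i)) (c (b, j)) = `[< S b.-2 j i >].
  move=> a1 b1; have Eb : b = b.-2.+2 :> nat by lia.
  have bk : b.-2 < k by have := ltn_ord b; lia.
  apply/idP/asboolP => [E|/(f_rel bk (leM j) (leM i))].
    apply/(f_rel bk (leM j) (leM i)); exists (c (b, j)), (c (a, i)).
    rewrite -Eb -a1 ca ca !cX; split=> //; split=> //.
    by rewrite cf ?(ltnW b1) // adj_sym E adj_sym cf // a1.
  (* Uniqueness of mates forces the path witnessing [srel] through the chosen cells. *)
  case=> u [v [[uX]]]; rewrite -Eb => bu [[vX]]; rewrite -a1 => av [ju [uv vi]].
  have -> : c (a, i) = v by apply: c_uniq => //; [rewrite a1|rewrite adj_sym].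
  have -> : c (b, j) = u by apply: c_uniq => //; apply: ltnW.
  by rewrite adj_sym.
have c_adj (a b : 'I_k.+2) (i j : 'I_M.+1) : adj (c (a, i)) (c (b, j)) = cell_adj S a b i j.
  rewrite /cell_adj; case: (posnP a) => [a0|a_gt0].
    rewrite c0 //; case: (posnP b) => [b0|b_gt0].
      rewrite c0 //; have [/val_inj ->|nij] := eqVneq (i : nat) j.
        by rewrite adj_irrefl.
      have [/(f_inj (leM i) (leM j)) E|//] := clique _ (fX i (leM i)) (f0 i (leM i))
        _ (fX j (leM j)) (f0 j (leM j)).
      by rewrite E eqxx in nij.
    have [/val_inj ->|nij] := eqVneq (i : nat) j; first exact: cf.
    by apply/negP => /(c_mate b j i b_gt0) E; rewrite E eqxx in nij.
  case: (posnP b) => [b0|b_gt0].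
    rewrite adj_sym c0 //; have [/val_inj ->|nij] := eqVneq (i : nat) j; first exact: cf.
    by apply/negP => /(c_mate a i j a_gt0) E; rewrite E eqxx in nij.
  case: ifP => [/andP[/eqP a1 b1]|nab]; first exact: c_rel.
  case: ifP => [/andP[/eqP b1 a1]|nba]; first by rewrite adj_sym c_rel.
  apply/negP => /(link a b _ (cX _) (ca a i) _ (cX _) (ca b j)).
  by rewrite /linked; lia.
have mX q (a : 'I_k.+2) : adj (m a) (c q) = (a == q.1).
  case: q => b i; apply/idP/eqP => [E|->]; last exact: ca.
  exact: uniq_sort (cX (b, i)) E (ca b i).
apply/contains_inducedP.
exists (fun v : code_graph k M S => match v with inl a => m a | inr q => c q end).
  (* Markers differ because they see different cells; a cell sees the marker of its sort, whereas no
     marker sees another. *)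
  case=> [a|[a i]] [b|[b j]] E.
  - by congr inl; have := mX (a, ord0) a; rewrite eqxx E mX => /eqP.
  - by case: (m_nonadj (ltn_ord b) (ltn_ord a)); rewrite E ca.
  - by case: (m_nonadj (ltn_ord a) (ltn_ord b)); rewrite -E ca.
  - have Eab : a = b by apply/eqP; rewrite -(mX (b, j)) -E ca.
    subst b; congr (inr (_, _)).
    case: (posnP a) => [a0|a_gt0]; last by apply: (c_mate a) => //; rewrite E cf.
    by move: E; rewrite !c0 // => /(f_inj (leM i) (leM j))/val_inj.
case=> [a|[a i]] [b|[b j]] /=.
- exact/negP/m_nonadj.
- by rewrite mX.
- by rewrite adj_sym mX.
- exact: c_adj.
Qed.

End Embedding.

Section Copy.
Variables (k M : nat) (S : nat -> nat -> nat -> Prop) (g : code_graph k M S -> G).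
Hypotheses (g_inj : injective g) (g_adj : forall x y, adj (g x) (g y) = adj x y).
Hypothesis XE : X = [set g v | v : code_graph k M S].
Hypothesis mE : forall a : 'I_k.+2, m a = g (inl a).

Let cell a i := g (inr (a, i)).
Let base i := cell ord0 (inord i).

Lemma cell_in a i : cell a i \in X.
Proof. by rewrite XE; apply: imset_f. Qed.

Lemma cell_cell a b i j : adj (cell a i) (cell b j) = cell_adj S a b i j.
Proof. exact: g_adj. Qed.

Lemma mark_cell (a b : 'I_k.+2) i : adj (m a) (cell b i) = (a == b).
Proof. by rewrite mE g_adj. Qed.

(** Markers belong to [X] too, but they are pairwise nonadjacent, so only cells remain. *)
Lemma sort_cell (a : 'I_k.+2) x : x \in X -> adj (m a) x -> exists i, x = cell a i.
Proof.
rewrite XE => /imsetP[[b|[b i]] _ ->]; first by rewrite mE g_adj.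
by rewrite (mark_cell a b i) => /eqP ->; exists i.
Qed.

Lemma m0E : m 0 = m (ord0 : 'I_k.+2). Proof. by []. Qed.

Lemma copy_nonadj a b : a < k.+2 -> b < k.+2 -> ~ adj (m a) (m b).
Proof. by move=> ak bk; rewrite (mE (Ordinal ak)) (mE (Ordinal bk)) g_adj. Qed.

Lemma copy_layout : layout k (fun x => x \in X) sgrel.
Proof.
split; [|split; [|split]].
- move=> a b x xX /(sort_cell xX)[i ->] /=.
  by rewrite mark_cell => /eqP.
- move=> a b u uX /(sort_cell uX)[i ->] v vX /(sort_cell vX)[j ->] /=.
  by rewrite cell_cell /cell_adj /linked; case: (a : nat) (b : nat) => [|[|?]] [|[|?]].
- move=> x xX /(sort_cell (a := ord0) xX)[i ->] y yX /(sort_cell (a := ord0) yX)[j ->] /=.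
  rewrite cell_cell /cell_adj /=; have [/val_inj ->|] := eqVneq (i : nat) j; first by left.
  by right.
- move=> a a0 x xX /(sort_cell (a := ord0) xX)[i ->]; split=> [|u uX].
    exists (cell a i); split; first exact: cell_in.
    by rewrite /= mark_cell eqxx cell_cell /cell_adj /= eqn0Ngt a0 eqxx.
  have adjE j l : adj (cell ord0 j) (cell a l) = (j == l).
    by rewrite cell_cell /cell_adj /= eqn0Ngt a0.
  case/(sort_cell uX)=> j ->; rewrite /= adjE => /eqP ->; split.
    by move=> u' uX' /(sort_cell uX')[l ->]; rewrite adjE => /eqP ->.
  move=> x' xX' /(sort_cell (a := ord0) xX')[l ->].
  by rewrite adjE => /eqP ->.
Qed.

Lemma base_dom i : base i \in dom.
Proof. by rewrite inE cell_in m0E mark_cell. Qed.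

Lemma base_surj y : y \in dom -> exists2 i, i <= M & base i = y.
Proof.
rewrite inE => /andP[yX /(sort_cell (a := ord0) yX)[i ->]].
by exists i; rewrite /base ?inord_val // -ltnS.
Qed.

Lemma base_inj i j : i <= M -> j <= M -> base i = base j -> i = j.
Proof.
by move=> iM jM /g_inj[] /(congr1 val) /=; rewrite !inordK.
Qed.

Lemma base_rel r i j : r < k -> i <= M -> j <= M ->
  (srel r (base i) (base j) <-> S r i j).
Proof.
move=> rk iM jM; have rk' : r.+2 < k.+2 by [].
pose a := Ordinal rk'; pose b : 'I_k.+2 := Ordinal (isT : 1 < k.+2).
have aE (l l' : 'I_M.+1) : adj (cell a l) (cell b l') = `[< S r l l' >].
  by rewrite cell_cell.
split=> [|h].
  case=> u [v [[uX /(sort_cell (a := a) uX)[l ->]]]].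
  case=> [[vX /(sort_cell (a := b) vX)[l' ->]]].
  rewrite aE /base !cell_cell /cell_adj /= => -[/eqP <-] [/asboolP + /eqP E].
  by rewrite !inordK // in E *; rewrite E.
exists (cell a (inord i)), (cell b (inord j)).
rewrite !cell_in (mark_cell a) (mark_cell b) !eqxx; split=> //; split=> //.
rewrite aE !cell_cell /cell_adj /= eqxx; split=> //; split=> //.
by rewrite !inordK //; apply/asboolP.
Qed.

End Copy.
End MarkedGraph.

(** * A shallow monadic sentence defining the induced copies of a code graph *)

Lemma gdef_dom t i : gdef t 0 (fun G X m e => e i \in dom X m).
Proof.
have h := gdef_and (gdef_mem (gterm_var t i))
  (gdef_adj (gterm_mark t 0) (gterm_var t i)).
by apply: gdef_iff h => G X m e; rewrite inE; split=> /andP.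
Qed.

Lemma gdef_srel t r i j : gdef t 2 (fun G X m e => srel X m r (e i) (e j)).
Proof.
rewrite /srel; apply: gdef_ex; apply: gdef_ex; cbv beta delta [stail].
repeat (apply: gdef_and || apply: gdef_mem || apply: gdef_adj ||
  apply: gterm_mark || apply: gterm_var).
Qed.

Lemma gdef_sgrel t r i j : gdef t 0 (fun G X m e => sgrel m r (e i) (e j)).
Proof.
case: r => [|r] /=; first by apply: gdef_adj; apply: gterm_var.
by apply: gdef_adj; [apply: gterm_mark|apply: gterm_var].
Qed.

Lemma qdepth_exs m n (p : fo m n) : qdepth (fo_exs p) = n + qdepth p.
Proof. by elim: n p => [|n IH] p //=; rewrite IH /= addnS. Qed.

Lemma D_EMSO1_le F (p : fo 1 0) : defines_induced F p -> D_EMSO1 F <= 1 + qdepth p.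
Proof.
move=> pF; rewrite /D_EMSO1; case: ex_minnP => d _; apply.
by apply/asboolP; exists p.
Qed.

(** The sentence guesses [X] and the markers, then states layout, linear order, the axioms of [s]
    and [Th]. Only [Th] varies, so [C] depends on [s] alone. *)
Theorem code_graph_depth s : sys_ok s -> exists C, forall d Th M0,
  ndef d Th ->
  (forall M S e, agree (so s) M S (sstd s M) -> (Th nat (upto M) S e <-> M = M0)) ->
  D_EMSO1 (code_graph (so s) M0 (sstd s M0)) <= C + d.
Proof.
move=> ok; have [_ h0 _ _ [Ax [dA Axd] AxP]] := ok; set k := so s.
have [dL Ld] := fodef_linear; have [dG Gd] := fodef_layout k.
pose t := k.+2.
(* One set quantifier and [t.+1] markers give [t.+2]; the rest bounds the body, where decoding
   [srel] costs two quantifiers. *)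
exists (t.+2 + (dA + dL + dG + 3)) => d Th M0 Thd ThP.
set F := code_graph _ _ _.
have AxF : fodef Ax by exists dA.
have ThF : fodef Th by exists d.
(* The extra marker [m t] certifies that the domain is nonempty and supplies a default environment
   inside it. *)
pose Phi : gpred := fun G X m e => m t \in dom X m /\
  ((forall i j, i < t -> j < t -> ~ adj (m i) (m j)) /\
  (layout k (fun x => x \in X) (sgrel m) /\
  (linear (fun x => x \in dom X m) (srel X m) /\
  (Ax G (fun x => x \in dom X m) (srel X m) e /\
   Th G (fun x => x \in dom X m) (srel X m) e)))).
have base_def d' P : ndef d' P -> gdef t (d' + 2) (fun G X m e =>
    P G (fun x => x \in dom X m) (srel X m) e).
  apply: (gdef_nsem (D := fun G X m x => x \in dom X m) (S := @srel)) => [i|].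
    exact: gdef_leq (gdef_dom t i).
  exact: gdef_srel.
have Phid : gdef t (dA + dL + dG + 3 + d) Phi.
  apply: gdef_and.
    have h := gdef_and (gdef_mem (gterm_mark t t))
      (gdef_adj (gterm_mark t 0) (gterm_mark t t)).
    apply: (@gdef_leq _ 0) => //.
    by apply: gdef_iff h => G X m e; rewrite inE; split=> /andP.
  apply: gdef_and; first by apply: gdef_leq (gdef_nonadjacent t); lia.
  apply: gdef_and.
    apply: (@gdef_leq _ (dG + 0)); first lia.
    apply: (gdef_nsem (D := fun G X m x => x \in X) (S := fun G X m => sgrel m)) Gd => [i|].
      by apply: gdef_mem; apply: gterm_var.
    exact: gdef_sgrel.
  apply: gdef_and; first by apply: gdef_leq (base_def _ _ Ld); lia.
  by apply: gdef_and; [apply: gdef_leq (base_def _ _ Axd)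
    |apply: gdef_leq (base_def _ _ Thd)]; lia.
have [p pd hp] := Phid 0.
have PhiP (G : sgraph) (X : 1.-tuple {set G}) (m : t.+1.-tuple G) :
    sat X p m <-> Phi G (tnth X ord0) (mark m) (fun=> mark m t).
  have := hp G X m [tuple].
  have -> : [tuple of [tuple] ++ m] = m by apply: val_inj.
  suff -> : nth (mark m t) [tuple] = (fun=> mark m t) by [].
  by apply/funext => i; rewrite nth_nil.
suff pF : defines_induced F (fo_exs p).
  by apply: leq_trans (D_EMSO1_le pF) _; rewrite qdepth_exs; move: pd; rewrite /t; lia.
move=> G; split.
  case=> X /sat_exs[m /PhiP]; move: (tnth X ord0) (mark m) => {}X {}m.
  case=> m_dom [nonadj [lay [lin [hAx hTh]]]].
  (* The domain is enumerated as [[0 .. M]]; transported there, [Ax] forces the standard relations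
     and [Th] then forces [M = M0]. *)
  have [M [f [f_dom f_surj f_ord]]] := linear_enum m_dom lin.
  have f_inj i j : i <= M -> j <= M -> f i = f j -> i = j.
    move=> iM jM E; case: (ltngtP i j) => // /(f_ord _ _ _ _).
      by move=> /(_ iM jM); rewrite E; case: lin => irr _ /irr; case; apply: f_dom.
    by move=> /(_ jM iM); rewrite E; case: lin => irr _ /irr; case; apply: f_dom.
  have [i0 i0M fi0] := f_surj _ m_dom.
  pose S r i j := srel X m r (f i) (f j).
  have iso P : fodef P -> P G (fun x => x \in dom X m) (srel X m) (fun=> m t) ->
      P nat (upto M) S (fun=> i0).
    by move=> Pd; apply: (proj2 (fodef_iso (f := f) Pd _ _ _ _ _ _)).
  have S0 : ordered M S by move=> i j iM jM; apply: f_ord.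
  have /(AxP _ _ _ S0) Sa := iso _ AxF hAx.
  have /(ThP _ _ _ Sa) EM0 := iso _ ThF hTh; subst M.
  by apply: layout_embedding nonadj lay f_dom f_inj _ => r i j rk iM jM; apply: Sa.
case/contains_inducedP=> g g_inj g_adj.
(* Conversely, [X] is the vertex set of the copy, the first [t] markers are the images of [inl a],
   and the last one is element 0 of sort 0. *)
pose X := [set g v | v : F].
pose m : t.+1.-tuple G :=
  [tuple if unlift ord_max i is Some a then g (inl a)
         else g (inr (ord0, ord0)) | i < t.+1].
have mE (a : 'I_t) : mark m a = g (inl a).
  rewrite /mark tnth_mktuple; have -> : inord a = lift ord_max a :> 'I_t.+1.
    by apply: val_inj; rewrite /= /bump leqNgt ltn_ord inordK // leqW.
  by rewrite liftK.
have mt : mark m t = g (inr (ord0, ord0)).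
  rewrite /mark tnth_mktuple; have -> : inord t = ord_max :> 'I_t.+1.
    by apply: val_inj; rewrite /= inordK.
  by rewrite unlift_none.
exists [tuple X]; apply/sat_exs; exists m; apply/PhiP; rewrite /= (tnth_nth set0) /=.
have XE : X = [set g v | v : F] by [].
pose f i := g (inr (ord0, inord i)).
have f_dom := base_dom g_adj XE mE.
have f_surj := base_surj g_adj XE mE.
have f_inj := base_inj g_inj.
have f_rel := base_rel g_adj XE mE.
pose S r i j := srel X (mark m) r (f i) (f j).
have Sa : agree k M0 S (sstd s M0) by move=> r i j rk iM jM; apply: f_rel.
have S0 : ordered M0 S := agree_ordered ok Sa.
have f0 : f 0 = mark m t.
  by rewrite mt /f; congr (g (inr (_, _))); apply: val_inj; rewrite /= inordK.
have iso P : fodef P -> P nat (upto M0) S (fun=> 0) ->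
    P G (fun x => x \in dom X (mark m)) (srel X (mark m)) (fun=> mark m t).
  move=> Pd; apply: (proj1 (fodef_iso (f := f) Pd _ f_surj f_inj _ _ _)) => //.
  by move=> i _; apply: f_dom.
split; first by rewrite -f0; apply: f_dom.
split; first exact: copy_nonadj g_adj mE.
split; first exact: copy_layout g_adj XE mE.
split; last split.
- have Lnat : linear (upto M0) S.
    split; [|split] => x xM; first by rewrite S0 // ltnn.
      move=> y yM z zM; rewrite !S0 //; exact: ltn_trans.
    move=> y yM; rewrite !S0 //.
    by case: (ltngtP x y); auto.
  exact: iso fodef_linear Lnat.
- by apply: iso AxF _; apply/AxP.
- by apply: iso ThF _; apply/ThP.
Qed.

(** * Outgrowing every recursive bound *)

Lemma code_graph_clique k M S : M < D (code_graph k M S).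
Proof.
pose c (i : 'I_M.+1) : code_graph k M S := inr (ord0, i).
apply: (@depth_ge_clique _ M.+1 c) => i j nij.
by rewrite /= /cell_adj.
Qed.

Lemma D_EMSO_le F : D_EMSO F <= D_EMSO1 F.
Proof.
rewrite /D_EMSO; case: ex_minnP => d _; apply.
rewrite /D_EMSO1; case: ex_minnP => d1 /asboolP[p hp] _.
by apply/asboolP; exists 1, p.
Qed.

(** Since [f] need not be monotone, it is beaten at every argument up to [N]; this covers the exact
    values of both [D_EMSO1 F] and the smaller [D_EMSO F]. *)
Lemma succinct_graph f : total_recursive f ->
  exists F N, D_EMSO1 F <= N /\ forall j, j <= N -> f j < D F.
Proof.
case/axiomatic_bound=> s [C1 [ok h]].
have [C2 hC2] := code_graph_depth ok.
(* The depth bound [C2 + (a + C1)] then equals [2a], the number that the sentence names. *)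
pose a := C1 + C2; have [Th [M0 [Thd ThP fM0]]] := h a.
exists (code_graph (so s) M0 (sstd s M0)), a.*2; split.
  by apply: leq_trans (hC2 _ _ _ Thd ThP) _; rewrite /a; lia.
by move=> j /fM0 fj; apply: leq_ltn_trans fj (code_graph_clique _ _ _).
Qed.

Theorem theorem6p2 :
  ~ (exists f : nat -> nat,
       total_recursive f /\ forall F : sgraph, f (D_EMSO F) >= D F)
  /\
  ~ (exists f : nat -> nat,
       total_recursive f /\ forall F : sgraph, f (D_EMSO1 F) >= D F).
Proof.
split=> -[f [/succinct_graph[F [N [FN fN]]] h]].
  by have := leq_trans (fN _ (leq_trans (D_EMSO_le F) FN)) (h F); rewrite ltnn.
by have := leq_trans (fN _ FN) (h F); rewrite ltnn.
Qed.
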